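(* Let $K$ be a number field, $B$ a central simple $K$-algebra of degree $n\ge 3$, $L\subset B$ a subfield containing $K$ with $[L:K]=n$, and $\mathcal R$ a fixed maximal order of $B$ containing $\mathcal O_L$. Let $\{\mathcal D^{\mathbf a,\mathbf b,\mathbf c}\}$ be the family of $[K(\mathcal R):K]$ maximal orders of $B$ defined in the context, which are representatives of the isomorphism classes of maximal orders in $B$. Then the ring of integers $\mathcal O_L$ is contained in at least $[K(\mathcal R):L_0]$ of the $[K(\mathcal R):K]$ representatives $\{\mathcal D^{\mathbf a,\mathbf b,\mathbf c}\}$. Specifically, $\mathcal O_L\subset\mathcal D^{\mathbf 0,\mathbf b,\mathbf c}$ for all $\mathbf b,\mathbf c$.
   Context: Isomorphism of orders means $\mathcal O_K$-algebra isomorphism (equivalently, conjugacy by $B^\times$). Local notation. For a place $\nu$ of $K$, $B_\nu=K_\nu\otimes_KB\cong M_{r_\nu}(D_\nu)$ with $D_\nu$ a central division $K_\nu$-algebra of degree $m_\nu$, $n=r_\nu m_\nu$; $\nu$ totally ramifies in $B$ if $m_\nu=n$. For finite $\nu$, $\mathcal O_\nu$ is the valuation ring of $K_\nu$, $\Delta_\nu$ the unique maximal order of $D_\nu$, $\boldsymbol\pi$ a uniformizer of $\Delta_\nu$. For an order $\mathcal R$, $\mathcal R_\nu=\mathcal O_\nu\otimes_{\mathcal O_K}\mathcal R$ if $\nu$ is finite, $\mathcal R_\nu=B_\nu$ if $\nu$ is infinite. For a place $\mathfrak P\mid\nu$ of $L$, $r_{\mathfrak P}=[L_{\mathfrak P}:K_\nu]/m_\nu$,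 a positive integer; $\sum_{\mathfrak P\mid\nu}r_{\mathfrak P}=r_\nu$. Class field. $J_K,J_B$ are the idele groups, $\mathcal N(\mathcal R_\nu)$ the normalizer of $\mathcal R_\nu$ in $B_\nu^\times$, $\mathfrak N(\mathcal R)=J_B\cap\prod_\nu\mathcal N(\mathcal R_\nu)$, $nr:J_B\to J_K$ the map given by local reduced norms, $H_{\mathcal R}=K^\times nr(\mathfrak N(\mathcal R))$ (an open subgroup of finite index in $J_K$), $G_{\mathcal R}=J_K/H_{\mathcal R}$. $K(\mathcal R)/K$ is the finite abelian extension attached to $H_{\mathcal R}$ by class field theory, so $G:=\operatorname{Gal}(K(\mathcal R)/K)\cong G_{\mathcal R}$, the Artin symbol $(\nu,K(\mathcal R)/K)$ corresponding to the class of the idele with a uniformizer at $\nu$ and $1$ elsewhere. $K(\mathcal R)/K$ is unramified at all finite places. $L_0=L\cap K(\mathcal R)$. Type distance. For a finite place $\nu$ with $r_\nu>1$, every maximal order of $B_\nu$ is $\operatorname{End}_{\Delta_\nu}(\Lambda)$ for a free rank $r_\nu$ $\Delta_\nu$-lattice $\Lambda\subset D_\nu^{r_\nu}$, unique up to homothety. For $\mathcal E_\nu=\operatorname{End}_{\Delta_\nu}(\Lambda)$, $\mathcal E'_\nu=\operatorname{End}_{\Delta_\nu}(\Gamma)$, scale so that $\Gamma\subseteq\Lambda$ and choose a basis $e_i$ and integers $0\le a_1\le\dots\le a_{r_\nu}$ with $\Lambda=\bigoplus\Delta_\nu e_i$, $\Gamma=\bigoplus\Delta_\nu\boldsymbol\pi^{a_i}e_i$;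 put $td_\nu(\mathcal E_\nu,\mathcal E'_\nu)=\sum_i a_i\pmod{r_\nu}$. Choice of places. Let $\widehat L$ be the Galois closure of $L/K$, $\widehat L_0=\widehat L\cap K(\mathcal R)$, $\widehat H=\operatorname{Gal}(K(\mathcal R)/\widehat L_0)\le H=\operatorname{Gal}(K(\mathcal R)/L_0)\le G$. Write as direct products of cyclic groups $G/H=\langle\rho_1H\rangle\times\cdots\times\langle\rho_uH\rangle$, $H/\widehat H=\langle\sigma_1\widehat H\rangle\times\cdots\times\langle\sigma_s\widehat H\rangle$, $\widehat H=\langle\tau_1\rangle\times\cdots\times\langle\tau_t\rangle$, with $\rho_i\in G$, $\sigma_j\in H$. Choose (by Chebotarev) distinct finite places $\lambda_i,\mu_j,\nu_k$ of $K$, unramified in $\widehat L$ and not totally ramified in $B$, with $\rho_i=(\lambda_i,K(\mathcal R)/K)$; $\sigma_j=(\mu_j,K(\mathcal R)/K)$ and some place of $L$ above $\mu_j$ of inertia degree $1$; $\tau_k=(\nu_k,K(\mathcal R)/K)$ and $\nu_k$ splitting completely in $L$. (Then $r_{\mu_j}=r_{\nu_k}=n$.) Local orders. At each such place $\nu$, with $\mathfrak P_1,\dots,\mathfrak P_g$ the places of $L$ above it (for $\nu=\mu_j$ numbered so that $\mathfrak P_1$ has inertia degree $1$), identify $B_\nu$ with $M_{r_\nu}(D_\nu)$ so that $\mathcal R_\nu=M_{r_\nu}(\Delta_\nu)$ and $K_\nu\otimes_KL\cong\bigoplus L_{\mathfrak P_i}$ is embedded block diagonally, $\mathcal O_{\mathfrak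 P_i}$ mapping into the $i$-th diagonal block $M_{r_{\mathfrak P_i}}(\Delta_\nu)$. A class $[a_1,\dots,a_{r_\nu}]\in\mathbb Z^{r_\nu}/\mathbb Z(1,\dots,1)$ represents the maximal order $xM_{r_\nu}(\Delta_\nu)x^{-1}$, $x=\operatorname{diag}(\boldsymbol\pi^{a_1},\dots,\boldsymbol\pi^{a_{r_\nu}})$. Let $\mathcal R_\nu(k,\ell)$ be the order represented by $[\ell,\dots,\ell,0,\dots,0]$ ($k$ entries equal to $\ell$). For $\lambda=\lambda_i$ put $f_\lambda=f(\lambda;L_0/K)$ (inertia degree; this equals the order of $\rho_iH$ and divides $r_\lambda$), $d_\lambda=\gcd(r_{\mathfrak P_1},\dots,r_{\mathfrak P_g})$, and fix integers $\ell_1,\dots,\ell_g$ with $d_\lambda=\sum_k r_{\mathfrak P_k}\ell_k$. For $m\in\mathbb Z/f_\lambda\mathbb Z$ with $m\equiv d_\lambda a$, $0\le a<f_\lambda/\gcd(d_\lambda,f_\lambda)$, let $\mathcal R_\lambda^m$ be the order represented by the class whose $k$-th block of $r_{\mathfrak P_k}$ entries all equal $a\ell_k$ ($k=1,\dots,g$); for each remaining residue, with least non-negative representative $m$, let $\mathcal R_\lambda^m$ be any chosen maximal order with $td_\lambda(\mathcal R_\lambda,\mathcal R_\lambda^m)\equiv m\pmod{r_\lambda}$. Global orders. For $\mathbf a=(a_i)\in\prod_i\mathbb Z/|\rho_iH|\mathbb Z$, $\mathbf b=(b_j)\in\prod_j\mathbb Z/|\sigma_j\widehat H|\mathbb Z$,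 $\mathbf c=(c_k)\in\prod_k\mathbb Z/|\tau_k|\mathbb Z$ (coordinates taken as least non-negative residues; $|\cdot|$ the order of the element in the respective group), $\mathcal D^{\mathbf a,\mathbf b,\mathbf c}$ is the maximal order of $B$ whose completion at a finite place $\mathfrak p$ is $\mathcal R_{\mathfrak p}$ if $\mathfrak p\notin\{\lambda_i,\mu_j,\nu_k\}$, $\mathcal R_{\lambda_i}^{a_i}$ if $\mathfrak p=\lambda_i$, $\mathcal R_{\mu_j}(1,b_j)$ if $\mathfrak p=\mu_j$, and $\mathcal R_{\nu_k}(c_k,1)$ if $\mathfrak p=\nu_k$. The paper shows that every maximal order of $B$ is isomorphic to exactly one $\mathcal D^{\mathbf a,\mathbf b,\mathbf c}$. *)

(* Defs.v *)
From HB Require Import structures.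
From mathcomp Require Import all_boot all_order all_algebra all_fingroup.
From mathcomp Require Import all_solvable all_field.
From mathcomp Require Import boolp classical_sets functions cardinality reals.

Set Implicit Arguments.
Unset Strict Implicit.
Unset Printing Implicit Defensive.

Import Order.TTheory GRing.Theory Num.Theory.
Local Open Scope classical_set_scope.
Local Open Scope ring_scope.

Definition ring_of_integers (F : fieldType) : set F :=
  [set x | integralOver (intr : int -> F) x].

Definition lattice_span (F : fieldType) (A : set F) (V : lmodType F)
    (s : seq V) : set V :=
  [set x | exists2 c : 'I_(size s) -> F,
     forall i, A (c i) & x = \sum_(i < size s) c i *: s`_i].

(* [A] is meant to be a subring of [F] with fraction field [F]. Closure of [O]
   under addition and under scaling by [A] comes from the last clause. *)
Definition is_order (F : fieldType) (A : set F) (V : falgType F)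
    (O : set V) : Prop :=
  [/\ O 1, forall x y, O x -> O y -> O (x * y) &
      exists2 s : seq V, <<s>>%VS = fullv & O = lattice_span A s].

Definition maximal_order (F : fieldType) (A : set F) (V : falgType F)
    (O : set V) : Prop :=
  is_order A O /\ forall O', is_order A O' -> O `<=` O' -> O' = O.

Definition central_simple (F : fieldType) (V : falgType F) (n : nat) : Prop :=
  [/\ 'Z({:V})%VS = 1%VS,
      forall I : {vspace V}, (fullv * I <= I)%VS -> (I * fullv <= I)%VS ->
        I = 0%VS \/ I = fullv
    & \dim {:V} = (n ^ 2)%N].

Definition central_division (F : fieldType) (V : falgType F) (m : nat) : Prop :=
  [/\ 'Z({:V})%VS = 1%VS, forall x : V, x != 0 -> x \is a GRing.unit
    & \dim {:V} = (m ^ 2)%N].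

(* [N] is computed as the determinant after some scalar extension [E] at which
   [V] is embedded in, hence (by dimension) generates, the matrix algebra. *)
Definition is_reduced_norm (F : fieldType) (V : falgType F) (n : nat)
    (N : V -> F) : Prop :=
  exists (E : fieldExtType F) (h : {rmorphism V -> 'M[E]_n}),
    (forall a : F, h a%:A = (a%:A)%:M) /\ forall x, \det (h x) = (N x)%:A.

Definition absolute_value (R : realType) (F : fieldType) (f : F -> R) : Prop :=
  [/\ forall x, 0 <= f x, forall x, (f x == 0) = (x == 0),
      forall x y, f (x * y) = f x * f y &
      forall x y, f (x + y) <= f x + f y].

Definition is_finite_abs (R : realType) (F : fieldType) (f : F -> R) : Prop :=
  (forall x y, f (x + y) <= Num.max (f x) (f y)) /\
  f @` [set x | x != 0] = range (fun z : int => (2 : R) ^ z).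

Definition is_infinite_abs (R : realType) (F : fieldType) (f : F -> R) : Prop :=
  forall m : nat, f m%:R = m%:R.

(* A place of a number field is given by the unique suitably normalised
   absolute value in its class: x |-> 2^-v(x) for a normalised discrete
   valuation v, or an absolute value extending the usual one of the rationals.
   The base 2 is immaterial. *)
Record place (R : realType) (F : fieldType) := Place {
  pabs :> F -> R;
  pabs_abs : absolute_value pabs;
  pabs_norm : is_finite_abs pabs \/ is_infinite_abs pabs }.

Definition finite_place (R : realType) (F : fieldType) (v : place R F) : Prop :=
  is_finite_abs v.

Definition is_completion (R : realType) (F : fieldType) (v : place R F)
    (E : fieldType) (absE : E -> R) (i : F -> E) : Prop :=
  [/\ absolute_value absE,
      forall x, absE (i x) = v x,
      forall (y : E) (e : R), 0 < e -> exists x, absE (y - i x) < e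
    & forall u : nat -> E,
        (forall e, 0 < e -> exists N, forall j k, (N <= j)%N -> (N <= k)%N ->
           absE (u j - u k) < e) ->
        exists l, forall e, 0 < e -> exists N, forall j, (N <= j)%N ->
           absE (u j - l) < e].

(* The exponent [e] is the ramification index. *)
Definition lies_over_with (R : realType) (F : fieldType) (E : fieldExtType F)
    (v : place R F) (w : place R E) (e : nat) : Prop :=
  (0 < e)%N /\ forall x : F, w x%:A = v x ^+ e.

Definition lies_over (R : realType) (F : fieldType) (E : fieldExtType F)
    (v : place R F) (w : place R E) : Prop :=
  exists e, lies_over_with v w e.

Definition unramified (R : realType) (F : fieldType) (E : fieldExtType F)
    (v : place R F) : Prop :=
  forall w : place R E, lies_over v w -> lies_over_with v w 1.

(* The residue classes of the [x i] form a basis of the residue field of [w]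
   over that of [v]. *)
Definition inertia_degree (R : realType) (F : fieldType) (E : fieldExtType F)
    (v : place R F) (w : place R E) (f : nat) : Prop :=
  exists x : 'I_f -> E,
  [/\ forall i, w (x i) <= 1,
      forall y, w y <= 1 -> exists2 c : 'I_f -> F, forall i, v (c i) <= 1 &
        w (y - \sum_i c i *: x i) < 1
    & forall c : 'I_f -> F, (forall i, v (c i) <= 1) ->
        w (\sum_i c i *: x i) < 1 -> forall i, v (c i) < 1].

Definition splits_completely (R : realType) (F : fieldType)
    (E : fieldExtType F) (v : place R F) : Prop :=
  forall w : place R E, lies_over v w ->
    lies_over_with v w 1 /\ inertia_degree v w 1.

(* The list [s] is a system of representatives of the residue field. *)
Definition residue_card (R : realType) (F : fieldType) (v : place R F)
    (q : nat) : Prop :=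
  exists s : seq F, [/\ size s = q, forall a, a \in s -> v a <= 1 &
    forall x, v x <= 1 -> count (fun a => v (x - a) < 1) s = 1%N].

(* Only meaningful if [v] is unramified in the abelian extension [E]. *)
Definition artin_symbol (R : realType) (F : fieldType)
    (M : splittingFieldType F) (E : {subfield M}) (v : place R F)
    (g : gal_of E) : Prop :=
  g \in 'Gal(E / 1)%g /\
  exists2 q, residue_card v q &
    forall w : place R (subvs_of E), lies_over v w ->
    forall x, w x <= 1 -> w (vsproj E (g (vsval x)) - x ^+ q) < 1.

(* [locB] exhibits [locA] as the base change of [B]: it sends a basis of [B]
   over [K] to a basis of [locA] over the completion. *)
Record localization (R : realType) (K : fieldType) (B : falgType K) (n : nat)
    (v : place R K) := Localization {
  locF : fieldType;
  locabs : locF -> R;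
  loci : {rmorphism K -> locF};
  loc_completion : is_completion v locabs loci;
  locA : falgType locF;
  locB : {rmorphism B -> locA};
  locB_semilinear : forall (a : K) (x : B), locB (a *: x) = loci a *: locB x;
  locB_basis : basis_of {:locA} [seq locB e | e <- vbasis {:B}];
  locnr : locA -> locF;
  locnr_reduced_norm : is_reduced_norm n locnr }.

Arguments loci {R K B n v} l.
Arguments locB {R K B n v} l.
Arguments locabs {R K B n v} l _.
Arguments locnr {R K B n v} l _.

Definition loc_integers (R : realType) (K : fieldType) (B : falgType K)
    (n : nat) (v : place R K) (l : localization B n v) : set (locF l) :=
  [set x | locabs l x <= 1].
Arguments loc_integers {R K B n v} l _.

Definition localize (R : realType) (K : fieldType) (B : falgType K)
    (n : nat) (v : place R K) (l : localization B n v) (O : set B) :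
    set (locA l) :=
  [set y | finite_place v -> exists s : seq B, [set` s] `<=` O /\
     lattice_span (loc_integers l) [seq locB l x | x <- s] y].
Arguments localize {R K B n v} l O _.

Section Ideles.
Variables (R : realType) (K : fieldType) (B : falgType K) (n : nat).
Variable loc : forall v : place R K, localization B n v.

Definition idele_K (x : forall v, locF (loc v)) : Prop :=
  (forall v, x v != 0) /\
  finite_set [set v | finite_place v /\ locabs (loc v) (x v) != 1].

Definition idele_B (O : set B) (y : forall v, locA (loc v)) : Prop :=
  (forall v, y v \is a GRing.unit) /\
  finite_set [set v | finite_place v /\
    ~ (localize (loc v) O (y v) /\ localize (loc v) O (y v)^-1)].

Definition idele_normalizer (O : set B) (y : forall v, locA (loc v)) : Prop :=
  idele_B O y /\
  forall v z, localize (loc v) O (y v * z * (y v)^-1) <-> localize (loc v) O z.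

Definition idele_H (O : set B) (x : forall v, locF (loc v)) : Prop :=
  exists2 a : K, a != 0 & exists2 y, idele_normalizer O y &
    forall v, x v = loci (loc v) a * locnr (loc v) (y v).

Definition uniformizer_idele (v : place R K) (x : forall w, locF (loc w)) :
    Prop :=
  locabs (loc v) (x v) = 2^-1 /\ forall w, w <> v -> x w = 1.

(* [E] is the class field of the group [idele_H O]: the reciprocity map
   identifies its Galois group with the ideles modulo [idele_H O]. *)
Definition class_field (O : set B) (M : splittingFieldType K)
    (E : {subfield M}) : Prop :=
  [/\ galois 1 E, abelian 'Gal(E / 1),
      forall v : place R K, finite_place v -> unramified (subvs_of E) v &
  exists art : (forall v, locF (loc v)) -> gal_of E,
  [/\ forall x y, idele_K x -> idele_K y ->
        art (fun v => x v * y v) = (art x * art y)%g,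
      forall x, idele_K x -> art x \in 'Gal(E / 1)%g,
      forall g, g \in 'Gal(E / 1)%g -> exists2 x, idele_K x & art x = g,
      forall x, idele_K x -> (art x = 1%g <-> idele_H O x) &
      forall v x g, finite_place v -> uniformizer_idele v x ->
        (artin_symbol v g <-> art x = g)]].

End Ideles.

Definition is_uniformizer (F : fieldType) (D : falgType F) (Delta : set D)
    (p : D) : Prop :=
  p != 0 /\
  [set x | Delta x /\ ~ (x \is a GRing.unit /\ Delta x^-1)] =
  [set p * y | y in Delta].

(* The identification [fr_phi] of the local algebra with matrices of size
   \sum_i r_i over [fr_D], adapted to the order [O] and to the places
   [fr_P i] of [L] over [v]. *)
Record local_frame (R : realType) (K : fieldType) (B : falgType K) (n : nat)
    (M : splittingFieldType K) (L : {subfield M})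
    (iota : {lrmorphism subvs_of L -> B}) (O : set B) (v : place R K)
    (l : localization B n v) := LocalFrame {
  fr_m : nat;
  fr_D : falgType (locF l);
  fr_D_division : central_division fr_D fr_m;
  fr_Delta : set fr_D;
  fr_Delta_max : maximal_order (loc_integers l) fr_Delta;
  fr_pi : fr_D;
  fr_pi_unif : is_uniformizer fr_Delta fr_pi;
  fr_g : nat;
  fr_P : 'I_fr_g -> place R (subvs_of L);
  fr_P_inj : injective fr_P;
  fr_P_over : forall w, lies_over v w <-> exists i, fr_P i = w;
  fr_LP : 'I_fr_g -> fieldExtType (locF l);
  fr_absLP : forall i, fr_LP i -> R;
  fr_iLP : forall i, {rmorphism subvs_of L -> fr_LP i};
  fr_LP_completion : forall i, is_completion (fr_P i) (@fr_absLP i) (fr_iLP i);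
  fr_iLP_K : forall i (a : K), fr_iLP i a%:A = (loci l a)%:A;
  fr_LP_abs : forall i, exists e, forall c : locF l,
    fr_absLP (c%:A : fr_LP i) = locabs l c ^+ e;
  fr_r : 'I_fr_g -> nat;
  fr_rE : forall i, (fr_r i * fr_m)%N = \dim {:fr_LP i};
  fr_phi : {rmorphism locA l -> 'M[fr_D]_(\sum_i fr_r i)};
  fr_phi_bij : bijective fr_phi;
  fr_phi_scalar : forall c : locF l, fr_phi c%:A = (c%:A)%:M;
  fr_phi_order : forall y,
    localize l O y <-> forall i j, fr_Delta (fr_phi y i j);
  fr_psi : forall i, {rmorphism fr_LP i -> 'M[fr_D]_(fr_r i)};
  fr_psi_scalar : forall i (c : locF l), fr_psi i c%:A = (c%:A)%:M;
  fr_psi_integers : forall i (x : fr_LP i), fr_absLP x <= 1 ->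
    forall j k, fr_Delta (fr_psi i x j k);
  fr_psi_diag : forall x : subvs_of L,
    fr_phi (locB l (iota x)) = \mxdiag_i fr_psi i (fr_iLP i x) }.

Arguments fr_phi {R K B n M L iota O v l} fr : rename.
Arguments fr_psi {R K B n M L iota O v l} fr : rename.
Arguments fr_iLP {R K B n M L iota O v l} fr : rename.
Arguments fr_r {R K B n M L iota O v l} fr _ : rename.
Arguments fr_P {R K B n M L iota O v l} fr _ : rename.

Section LocalOrders.
Variables (R : realType) (K : fieldType) (B : falgType K) (n : nat).
Variables (M : splittingFieldType K) (L : {subfield M}).
Variables (iota : {lrmorphism subvs_of L -> B}) (O : set B) (v : place R K).
Variables (l : localization B n v) (fr : local_frame iota O l).

Definition fr_size : nat := (\sum_i fr_r fr i)%N.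

Definition pi_diag (a : 'I_fr_size -> int) : 'M[fr_D fr]_fr_size :=
  diag_mx (\row_i (fr_pi fr) ^ a i).

Definition Delta_mx : set 'M[fr_D fr]_fr_size :=
  [set A | forall i j, fr_Delta (A i j)].

(* The order of the local algebra represented by the class of [a]. *)
Definition class_order (a : 'I_fr_size -> int) : set (locA l) :=
  [set y | exists2 A, Delta_mx A &
     fr_phi fr y = pi_diag a *m A *m pi_diag (fun i => - a i)].

Definition step_order (k : nat) (e : int) : set (locA l) :=
  class_order (fun i => if (i < k)%N then e else 0).

(* Columns carry the matrices on the left and the scalars on the right. *)
Definition free_lattice (P : 'M[fr_D fr]_fr_size) : set 'cV[fr_D fr]_fr_size :=
  [set w | exists2 u : 'cV_fr_size, forall i j, fr_Delta (u i j) & w = P *m u].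

Definition End_lattice (X : set 'cV[fr_D fr]_fr_size) : set (locA l) :=
  [set y | forall u, X u -> X (fr_phi fr y *m u)].

Definition type_distance (E E' : set (locA l)) (t : nat) : Prop :=
  exists (P Q : 'M[fr_D fr]_fr_size) (a : 'I_fr_size -> nat),
  [/\ P *m Q = 1%:M /\ Q *m P = 1%:M,
      forall i j : 'I_fr_size, (i <= j)%N -> (a i <= a j)%N,
      E = End_lattice (free_lattice P),
      E' = End_lattice (free_lattice (P *m pi_diag (fun i => (a i)%:Z)))
    & (\sum_i a i = t %[mod fr_size])%N].

(* [X m] is the order attached to the residue [m] modulo [f]; [tagnat.sig1 i]
   is the block containing the index [i]. *)
Definition lambda_orders (f : nat) (ell : 'I_(fr_g fr) -> int)
    (X : nat -> set (locA l)) : Prop :=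
  let d := (\big[gcdn/0]_k fr_r fr k)%N in
  d%:Z = \sum_k (fr_r fr k)%:Z * ell k /\
  forall m, (m < f)%N ->
    (forall a, (a < f %/ gcdn d f)%N -> m = d * a %[mod f] ->
       X m = class_order (fun i => a%:Z * ell (tagnat.sig1 i))) /\
    ((forall a, (a < f %/ gcdn d f)%N -> m <> d * a %[mod f]) ->
       maximal_order (loc_integers l) (X m) /\
       type_distance (localize l O) (X m) m).

End LocalOrders.

Definition is_galois_closure (F : fieldType) (M : splittingFieldType F)
    (L N : {subfield M}) : Prop :=
  [/\ (L <= N)%VS, galois 1 N &
      forall E : {subfield M}, galois 1 E -> (L <= E)%VS -> (N <= E)%VS].

Definition gal_inter (F : fieldType) (M : splittingFieldType F)
    (E L : {subfield M}) : {group gal_of E} := 'Gal(E / (L :&: E)%AS)%G.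

(* [E] is the class field attached to [O] and [N] the Galois closure of [L];
   the
   groups H and H^ are [gal_inter E L] and [gal_inter E N]. *)
Record place_choice (R : realType) (K : fieldType) (B : falgType K) (n : nat)
    (M : splittingFieldType K) (L N E : {subfield M})
    (iota : {lrmorphism subvs_of L -> B}) (O : set B)
    (loc : forall v : place R K, localization B n v) := PlaceChoice {
  pc_u : nat;
  pc_s : nat;
  pc_t : nat;
  rho : 'I_pc_u -> gal_of E;
  sigma : 'I_pc_s -> gal_of E;
  tau : 'I_pc_t -> gal_of E;
  sigma_H : forall j, sigma j \in gal_inter E L;
  rho_dprod :
    \big[dprod/1%g]_(i < pc_u) <[coset (gal_inter E L) (rho i)]>%g =
      ('Gal(E / 1) / gal_inter E L)%g;
  sigma_dprod :
    \big[dprod/1%g]_(j < pc_s) <[coset (gal_inter E N) (sigma j)]>%g =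
      (gal_inter E L / gal_inter E N)%g;
  tau_dprod : \big[dprod/1%g]_(k < pc_t) <[tau k]>%g = gal_inter E N;
  lam : 'I_pc_u -> place R K;
  mu : 'I_pc_s -> place R K;
  nu : 'I_pc_t -> place R K;
  lam_inj : injective lam;
  mu_inj : injective mu;
  nu_inj : injective nu;
  lam_mu : forall i j, lam i <> mu j;
  lam_nu : forall i k, lam i <> nu k;
  mu_nu : forall j k, mu j <> nu k;
  lam_finite : forall i, finite_place (lam i);
  mu_finite : forall j, finite_place (mu j);
  nu_finite : forall k, finite_place (nu k);
  lam_unramified : forall i, unramified (subvs_of N) (lam i);
  mu_unramified : forall j, unramified (subvs_of N) (mu j);
  nu_unramified : forall k, unramified (subvs_of N) (nu k);
  lam_artin : forall i, artin_symbol (lam i) (rho i);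
  mu_artin : forall j, artin_symbol (mu j) (sigma j);
  nu_artin : forall k, artin_symbol (nu k) (tau k);
  lam_frame : forall i, local_frame iota O (loc (lam i));
  mu_frame : forall j, local_frame iota O (loc (mu j));
  nu_frame : forall k, local_frame iota O (loc (nu k));
  lam_not_tot_ramified : forall i, fr_m (lam_frame i) <> n;
  mu_not_tot_ramified : forall j, fr_m (mu_frame j) <> n;
  nu_not_tot_ramified : forall k, fr_m (nu_frame k) <> n;
  mu_first : forall j, exists2 i : 'I_(fr_g (mu_frame j)), i = 0%N :> nat &
    inertia_degree (mu j) (fr_P (mu_frame j) i) 1;
  nu_splits : forall k, splits_completely (subvs_of L) (nu k);
  lam_f : 'I_pc_u -> nat;
  lam_fP : forall i, exists2 w : place R (subvs_of (L :&: E)%AS),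
    lies_over (lam i) w & inertia_degree (lam i) w (lam_f i);
  lam_ell : forall i, 'I_(fr_g (lam_frame i)) -> int;
  lam_order : forall i, nat -> set (locA (loc (lam i)));
  lam_orderP : forall i, lambda_orders (lam_f i) (@lam_ell i) (@lam_order i) }.

Arguments lam_order {R K B n M L N E iota O loc} p i _.
Arguments mu_frame {R K B n M L N E iota O loc} p j.
Arguments nu_frame {R K B n M L N E iota O loc} p k.
Arguments lam {R K B n M L N E iota O loc} p i.
Arguments mu {R K B n M L N E iota O loc} p j.
Arguments nu {R K B n M L N E iota O loc} p k.

Section Family.
Variables (R : realType) (K : fieldType) (B : falgType K) (n : nat).
Variables (M : splittingFieldType K) (L N E : {subfield M}).
Variables (iota : {lrmorphism subvs_of L -> B}) (O : set B).
Variable loc : forall v : place R K, localization B n v.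
Variable C : place_choice N E iota O loc.

Definition index_a : finType :=
  {dffun forall i : 'I_(pc_u C), 'I_(#[coset (gal_inter E L) (rho i)]%g)}.
Definition index_b : finType :=
  {dffun forall j : 'I_(pc_s C), 'I_(#[coset (gal_inter E N) (sigma j)]%g)}.
Definition index_c : finType :=
  {dffun forall k : 'I_(pc_t C), 'I_(#[tau k]%g)}.

Definition is_global_order (a : index_a) (b : index_b) (c : index_c)
    (X : set B) : Prop :=
  maximal_order (@ring_of_integers K) X /\
  [/\ forall p, finite_place p -> (forall i, p <> lam C i) ->
        (forall j, p <> mu C j) -> (forall k, p <> nu C k) ->
        localize (loc p) X = localize (loc p) O,
      forall i, localize (loc (lam C i)) X = lam_order C i (a i),
      forall j, localize (loc (mu C j)) X =
        step_order (mu_frame C j) 1 (b j)%:Z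
    & forall k, localize (loc (nu C k)) X = step_order (nu_frame C k) (c k) 1].

End Family.

(* Main.v *)
Require Import Defs.
From HB Require Import structures.
From mathcomp Require Import all_boot all_order all_algebra all_fingroup.
From mathcomp Require Import all_solvable all_field.
From mathcomp Require Import boolp classical_sets functions cardinality reals.
From mathcomp Require Import ring zify.

(** Write [O_L] for the ring of integers of [L].  By the local-global principle,
    [O_L] lies in a maximal order as soon as it does so at every finite place,
    so only the places [lam], [mu] and [nu] matter, and at [lam] there is nothing
    to do when the index is zero.  In the local frame [O_L] is block diagonal with
    entries in [Delta], and the completions of [L] of local degree one give blocks
    of size one: the first block at [mu] (unramified of inertia degree one), all
    blocks at [nu].  Conjugating by a diagonal matrix of nonnegative powers of the
    uniformizer that is constant on blocks therefore preserves the integrality of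
    the entries.

    The orders with index zero at [lam] are pairwise distinct because the orders
    of the classes [[b,0,...,0]] and [[1,...,1,0,...,0]] are, the number [c] of ones
    being less than [n]: the reduced norm of a scalar [x] is [x ^+ n], so the
    exponent of the class group divides [n].

    The local-global principle needs a place of [K] for every maximal ideal [P]
    of the ring of integers [A].  If [m] is in [P], finiteness of [A / mA] yields
    [theta] outside [A] with [theta * P] inside [A]; were [theta * P] inside [P], a
    pigeonhole argument on the powers of [theta] would make it integral.  So
    [theta * p] is in [A] and outside [P] for some [p] in [P], and [p] is a
    uniformizer of the localization at [P]. *)

Set Implicit Arguments.
Unset Strict Implicit.
Unset Printing Implicit Defensive.

Import Order.TTheory GRing.Theory Num.Theory.
Local Open Scope classical_set_scope.
Local Open Scope card_scope.
Local Open Scope ring_scope.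

(** * Rings of integers and their prime ideals *)

Section RingOfIntegers.
Variable F : fieldType.
Local Notation A := (@ring_of_integers F).

Lemma roi_int (z : int) : A z%:~R. Proof. exact: integral_id. Qed.
Lemma roi_nat (m : nat) : A m%:R. Proof. exact: integral_nat. Qed.
Lemma roi0 : A 0. Proof. exact: integral0. Qed.
Lemma roi1 : A 1. Proof. exact: integral1. Qed.

Lemma roiD x y : A x -> A y -> A (x + y).
Proof. exact: (integral_add (RtoK := intmul (1 : F))). Qed.

Lemma roiB x y : A x -> A y -> A (x - y).
Proof. exact: (integral_sub (RtoK := intmul (1 : F))). Qed.

Lemma roiM x y : A x -> A y -> A (x * y).
Proof. exact: (integral_mul (RtoK := intmul (1 : F))). Qed.

Lemma roiN x : A x -> A (- x).
Proof. by move=> /(roiB roi0); rewrite sub0r. Qed.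

Lemma roiX x k : A x -> A (x ^+ k).
Proof.
by move=> Ax; elim: k => [|k IH]; [exact: roi1 | rewrite exprS; exact: roiM].
Qed.

Lemma roi_sum (I : Type) (r : seq I) (Q : pred I) (f : I -> F) :
  (forall i, Q i -> A (f i)) -> A (\sum_(i <- r | Q i) f i).
Proof.
by move=> Af; apply: (big_ind A) => //; [exact: roi0 | exact: roiD].
Qed.

Lemma roi_root (p : {poly F}) x :
  p \is monic -> root p x -> (forall i, A p`_i) -> A x.
Proof.
move=> mp rp Ap; apply: (integral_root_monic mp rp).
exact/(integral_poly (intmul (1 : F)) p).
Qed.

(* [X^l - X^k - a] with [k < l] is monic with coefficients in the ring of
   integers. *)
Lemma roi_expr_sub x k l : (k < l)%N -> A (x ^+ l - x ^+ k) -> A x.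
Proof.
move=> lt_kl; set a := (x ^+ l - x ^+ k) => Aa.
have szl : (size (- ('X^k + a%:P) : {poly F})%R < size ('X^l : {poly F})%R)%N.
  rewrite size_polyN size_polyXn; apply: leq_ltn_trans (size_polyD _ _) _.
  rewrite size_polyXn gtn_max !ltnS lt_kl /=.
  exact: leq_trans (size_polyC_leq1 _) (leq_trans _ lt_kl).
apply: (@roi_root ('X^l - ('X^k + a%:P))).
- by rewrite monicE lead_coefDl // lead_coefXn.
- apply/rootP; rewrite hornerD hornerN hornerD !hornerXn hornerC /a.
  by rewrite [_ + (_ - _)]addrC subrK subrr.
- move=> i; rewrite coefB coefD !coefXn coefC.
  apply: roiB; [|apply: roiD]; try exact: roi_nat.
  by case: (i == 0)%N; [exact: Aa | exact: roi0].
Qed.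

End RingOfIntegers.

(* Number fields, without reference to a base field: a field of characteristic 0
   and finite degree over the rationals. *)
Definition int_dependent (F : fieldType) : Prop :=
  (forall m : nat, (0 < m)%N -> m%:R != 0 :> F) /\
  exists n, forall x : 'I_n -> F, exists c : 'I_n -> int,
    (exists i, c i != 0) /\ \sum_i (c i)%:~R * x i = 0.

Section NumberField.
Variable F : fieldType.
Hypothesis hF : int_dependent F.
Local Notation A := (@ring_of_integers F).

Lemma natf_neq0_id m : (0 < m)%N -> m%:R != 0 :> F.
Proof. by case: hF => h _; exact: h. Qed.

Lemma intf_eq0_id (z : int) : (z%:~R == 0 :> F) = (z == 0).
Proof.
apply/idP/idP => [|/eqP->] //; case: z => [[|m]|m] //.
  by rewrite -pmulrn (negbTE (natf_neq0_id _)).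
by rewrite NegzE mulrNz oppr_eq0 -pmulrn (negbTE (natf_neq0_id _)).
Qed.

(** The powers [1, x, ..., x ^+ n.-1] are dependent over the integers. *)
Lemma int_relation (x : F) :
  exists2 p : {poly int}, p != 0 & (map_poly intr p).[x] = 0.
Proof.
have [_ [n /(_ (fun i => x ^+ i)) [c [[i ci] e]]]] := hF.
exists (\poly_(j < n) oapp c 0 (insub j)).
  apply/eqP => /(congr1 (fun p : {poly int} => p`_i)).
  rewrite coef_poly ltn_ord coef0.
  case: insubP => [j _ ej|]; last by rewrite ltn_ord.
  by rewrite /= (val_inj ej) => e0; rewrite e0 eqxx in ci.
rewrite -[RHS]e.
have -> : map_poly intr (\poly_(j < n) oapp c 0 (insub j)) =
  \poly_(j < n) (oapp c 0 (insub j))%:~R :> {poly F}.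
  apply/polyP => j; rewrite coef_map !coef_poly /=.
  by case: (j < n)%N.
rewrite horner_poly; apply: eq_bigr => j _.
by case: insubP => [k _ /val_inj -> //|]; rewrite ltn_ord.
Qed.

(* Multiply by the leading coefficient of an integral relation. *)
Lemma roi_denom (x : F) : exists2 m : nat, (0 < m)%N & A (m%:R * x).
Proof.
have [p pn0 px] := int_relation x.
set c := lead_coef p; have cn0 : c != 0 by rewrite lead_coef_eq0.
suff Ac : A (c%:~R * x).
  exists `|c|%N; first by rewrite absz_gt0.
  have [e|e] : c = `|c|%N \/ c = - `|c|%N%:Z.
    by case: (c) => k; [left | right; rewrite NegzE abszN].
  - by rewrite pmulrn -e.
  - rewrite e mulrNz mulNr -pmulrn in Ac.
    by rewrite -[X in A X]opprK; exact: roiN.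
set d := (size p).-1.
have szp : size p = d.+1 by rewrite prednK // size_poly_gt0.
(* The monic [q] satisfies [q(c * x) = c ^+ d.-1 * p(x)], so [c * x] is a root of it. *)
pose q : {poly F} :=
  'X^d + \poly_(i < d) ((p`_i * c ^+ (d.-1 - i))%:~R).
have szq : (size (\poly_(i < d) ((p`_i * c ^+ (d.-1 - i))%:~R) : {poly F})%R
   < size ('X^d : {poly F})%R)%N.
  by rewrite size_polyXn ltnS size_poly.
apply: (@roi_root _ q).
- by rewrite monicE lead_coefDl // lead_coefXn.
- apply/rootP; rewrite /q hornerD hornerXn horner_poly.
  (* For [d = 0], where [d.-1] truncates, [p] would be a nonzero constant vanishing at [x]. *)
  case: (posnP d) => [d0|dgt0].
    have : (map_poly intr p : {poly F}).[x] = c%:~R.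
      have pE : p = c%:P by rewrite /c lead_coefE -/d d0 -size1_polyC // szp d0.
      by rewrite {1}pE map_polyC hornerC.
    by rewrite px => /eqP; rewrite eq_sym intf_eq0_id (negbTE cn0).
  have -> : (c%:~R * x) ^+ d = c%:~R ^+ d.-1 * (c%:~R * x ^+ d).
    by rewrite exprMn mulrA -exprSr prednK.
  have -> : \sum_(i < d) (p`_i * c ^+ (d.-1 - i))%:~R * (c%:~R * x) ^+ i =
     c%:~R ^+ d.-1 * \sum_(i < d) (p`_i)%:~R * x ^+ i.
    rewrite mulr_sumr; apply: eq_bigr => i _.
    rewrite rmorphM rmorphXn /= exprMn.
    have -> : c%:~R ^+ d.-1 = c%:~R ^+ (d.-1 - i) * c%:~R ^+ i :> F.
      by rewrite -exprD subnK // -ltnS prednK.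
    ring.
  rewrite -mulrDr addrC; have := px.
  rewrite horner_coef size_map_inj_poly //; last first.
    by move=> u v /eqP; rewrite -subr_eq0 -rmorphB /= intf_eq0_id subr_eq0 => /eqP.
  rewrite szp big_ord_recr /= coef_map /=.
  under eq_bigr do rewrite coef_map /=.
  by rewrite -[p`_d]/(lead_coef p) => ->; rewrite mulr0.
- move=> i; rewrite coefD coefXn coef_poly; apply: roiD; first exact: roi_nat.
  by case: ifP => _; [exact: roi_int | exact: roi0].
Qed.

(** Factors [X] are stripped from an integral relation of [a] until its constant term is nonzero; up
    to sign that term is [a] times an integral polynomial in [a]. *)
Lemma roi_dvd_nat (a : F) : A a -> a != 0 ->
  exists2 m : nat, (0 < m)%N & exists2 b, A b & a * b = m%:R.
Proof.
move=> Aa an0; have [p] := int_relation a.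
suff H : p != 0 -> (map_poly intr p).[a] = 0 ->
    exists2 c : int, c != 0 & exists2 b, A b & a * b = c%:~R.
  move=> pn0 pa; have [[m|m] cn0 [b Ab e]] := H pn0 pa.
    by exists m; [rewrite lt0n | exists b].
  exists m.+1 => //; exists (- b); first exact: roiN.
  by rewrite mulrN e NegzE mulrNz opprK.
elim/poly_ind: p => [|p c IH]; first by rewrite eqxx.
have [->|cn0] := eqVneq c 0.
  rewrite addr0 => pX; rewrite rmorphM /= map_polyX hornerMX => /eqP.
  rewrite mulf_eq0 (negbTE an0) orbF => /eqP; apply: IH.
  by apply: contraNneq pX => ->; rewrite mul0r.
move=> _ e; exists (- c); first by rewrite oppr_eq0.
exists (map_poly intr p).[a].
  rewrite horner_coef; apply: roi_sum => i _; apply: roiM; last exact: roiX.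
  by rewrite coef_map; exact: roi_int.
move: e; rewrite rmorphD rmorphM /= map_polyX map_polyC /= hornerD hornerMX hornerC.
by move=> /eqP; rewrite addr_eq0 => /eqP e; rewrite mulrC e mulrNz.
Qed.

(** A nontrivial relation is divided by the highest power of [p] common to its coefficients; the
    exponent is bounded because some coefficient is nonzero. *)
Lemma int_relation_mod (p : nat) : prime p ->
  exists n, forall x : 'I_n -> F, exists c : 'I_n -> int,
    (exists i, ~~ (p %| c i)%Z) /\ \sum_i (c i)%:~R * x i = 0.
Proof.
move=> pp; have [_ [n Hn]] := hF; exists n => x.
have [c [[i ci] e]] := Hn x.
have : exists k, [forall i, (p ^ k %| `|c i|)%N] by exists 0%N; apply/forallP => j.
have bnd k : [forall i, (p ^ k %| `|c i|)%N] -> (k <= `|c i|)%N.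
  move=> /forallP /(_ i) /dvdn_leq; rewrite absz_gt0 ci => /(_ isT).
  by apply: leq_trans; apply: ltnW; apply: ltn_expl; exact: prime_gt1.
move=> ex; case: (ex_maxnP ex bnd) => k /forallP kd kmax.
have pk0 : (p ^ k)%:Z != 0 by rewrite eqz_nat expn_eq0 negb_and -lt0n prime_gt0.
have ck j : c j = (c j %/ (p ^ k)%:Z)%Z * (p ^ k)%:Z.
  by rewrite divzK //; exact: kd.
exists (fun j => (c j %/ (p ^ k)%:Z)%Z); split.
  apply: contrapT => nex.
  have /kmax : [forall i, (p ^ k.+1 %| `|c i|)%N].
    apply/forallP => j; have [pj|npj] := boolP (p %| c j %/ (p ^ k)%:Z)%Z.
      by rewrite (ck j) abszM absz_nat expnS dvdn_mul.
    by case: nex; exists j.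
  by rewrite ltnn.
apply/eqP; have /mulIf : ((p ^ k)%:Z)%:~R != 0 :> F by rewrite intf_eq0_id.
move=> inj; apply/eqP/inj; rewrite mul0r mulr_suml -[RHS]e.
by apply: eq_bigr => j _; rewrite [in RHS](ck j) rmorphM /=; ring.
Qed.

(** * Finiteness of the quotients [A / mA] *)

Definition finite_mod (m : nat) : Prop :=
  exists2 T : seq F, forall t, t \in T -> A t &
    forall a, A a -> exists2 t, t \in T & exists2 b, A b & a = t + m%:R * b.

Lemma finite_modM m m' : finite_mod m -> finite_mod m' -> finite_mod (m * m').
Proof.
move=> [T AT HT] [T' AT' HT'].
exists [seq t + m%:R * t' | t <- T, t' <- T'].
  move=> ? /allpairsP [[t t'] /= [tT tT' ->]].
  by apply: roiD; [exact: AT | apply: roiM; [exact: roi_nat | exact: AT']].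
move=> a /HT [t tT [b /HT' [t' tT' [b' Ab' ->]] ->]].
exists (t + m%:R * t'); first by apply: allpairs_f.
by exists b' => //; rewrite natrM; ring.
Qed.

(* A maximal family of integers independent modulo [p] spans modulo [p]. *)
Lemma finite_mod_prime p : prime p -> finite_mod p.
Proof.
move=> pp; have [n Hn] := int_relation_mod pp.
have p0 : p%:Z != 0 by rewrite eqz_nat -lt0n prime_gt0.
pose indep (k : nat) := exists2 x : 'I_k -> F, forall i, A (x i) &
  forall c : 'I_k -> int, (exists2 b, A b & \sum_i (c i)%:~R * x i = p%:R * b) ->
    forall i, (p %| c i)%Z.
have [k [[x Ax indx] nindx]] : exists k, indep k /\ ~ indep k.+1.
  apply: contrapT => nex.
  have : indep n.
    elim: (n) => [|k IH]; first by exists (fun=> 0) => [i|c _ []//]; exact: roi0.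
    by apply: contrapT => nind; apply: nex; exists k.
  move=> [x Ax indx]; have [c [[i ci] e]] := Hn x.
  move: ci; apply/negP/negPn; apply: indx; exists 0; first exact: roi0.
  by rewrite e mulr0.
exists [seq \sum_i (f i)%:R * x i | f : {ffun 'I_k -> 'I_p}].
  move=> t /mapP [f _ ->]; apply: roi_sum => i _; apply: roiM; last exact: Ax.
  exact: roi_nat.
move=> a Aa; apply: contrapT => nspan; apply: nindx.
exists (fun i => oapp x a (unlift ord_max i)).
  by move=> i; case: unliftP => [j _|_] /=; [exact: Ax | exact: Aa].
move=> c [b Ab]; rewrite big_ord_recr /= unlift_none /=.
have wE (i : 'I_k) : widen_ord (leqnSn k) i = lift ord_max i.
  exact/val_inj/esym/lift_max.
under eq_bigr => i _ do rewrite wE liftK /=.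
set C := c ord_max => e.
have pC : (p %| C)%Z.
  apply: contrapT => npC; apply: nspan.
  have [u [w uw]] : exists u w : int, u * C + w * p%:Z = 1.
    have /coprimezP [[u w] /= e1] : coprimez C p%:Z.
      rewrite coprimezE absz_nat coprime_sym prime_coprime //.
      by apply/negP => h; apply: npC.
    by exists u, w.
  (* Multiplying the relation by [u], the inverse of [C] modulo [p], makes [a] congruent to the sum
     of the [z i * x i]. The residues of the [z i] then give an element of the list. *)
  pose z i := - u * c (lift ord_max i).
  have lt_z i : (`|(z i %% p%:Z)%Z| < p)%N.
    by rewrite -ltz_nat gez0_abs ?modz_ge0 // ltz_pmod // ltz_nat prime_gt0.
  exists (\sum_i (`|(z i %% p%:Z)%Z|)%:R * x i).
    apply/mapP; exists [ffun i => Ordinal (lt_z i)]; first by rewrite mem_enum.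
    by apply: eq_bigr => i _; rewrite ffunE.
  exists (u%:~R * b + w%:~R * a + \sum_i (z i %/ p%:Z)%Z%:~R * x i).
    apply: roiD; first by apply: roiD; apply: roiM => //; exact: roi_int.
    by apply: roi_sum => i _; apply: roiM; [exact: roi_int | exact: Ax].
  have zE : \sum_i (z i)%:~R * x i = \sum_i (`|(z i %% p%:Z)%Z|)%:R * x i +
      p%:R * \sum_i (z i %/ p%:Z)%Z%:~R * x i.
    rewrite mulr_sumr -big_split; apply: eq_bigr => i _ /=.
    rewrite {1}(divz_eq (z i) p%:Z) rmorphD rmorphM /= pmulrn gez0_abs ?modz_ge0 //.
    by rewrite -[p%:~R]pmulrn; ring.
  have : \sum_i (z i)%:~R * x i = - u%:~R * (p%:R * b - C%:~R * a).
    rewrite -e addrK mulr_sumr; apply: eq_bigr => i _.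
    by rewrite /z rmorphM rmorphN /= mulrA.
  rewrite zE => e2; have := congr1 (intmul (1 : F)) uw.
  rewrite rmorphD !rmorphM rmorph1 /= -[p%:~R]pmulrn => e3.
  rewrite mulrDr addrCA e2 -[LHS]mul1r -{1}e3; ring.
move=> i; case: (unliftP ord_max i) => [j ->|->] //.
apply: (indx (fun j => c (lift ord_max j))).
exists (b - (C %/ p%:Z)%Z%:~R * a).
  by apply: roiB => //; apply: roiM => //; exact: roi_int.
move: e; rewrite -{1}(divzK pC) rmorphM /= -[p%:~R]pmulrn => e.
by rewrite mulrBr -e; ring.
Qed.

Lemma finite_mod_gt0 m : (0 < m)%N -> finite_mod m.
Proof.
elim/ltn_ind: m => m IH m0; have [m1|m1] := leqP m 1.
  have -> : m = 1%N by apply/eqP; rewrite eqn_leq m1.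
  exists [:: 0]; first by move=> t; rewrite inE => /eqP ->; exact: roi0.
  by move=> a Aa; exists 0; rewrite ?inE //; exists a => //; rewrite add0r mul1r.
have pp := pdiv_prime m1; have pd := pdiv_dvd m.
have fm : finite_mod (m %/ pdiv m).
  apply: IH; first by rewrite ltn_Pdiv // prime_gt1.
  by rewrite divn_gt0 ?pdiv_gt0 // dvdn_leq.
have := finite_modM fm (finite_mod_prime pp).
by rewrite divnK.
Qed.

(** From each class that meets [Q] a representative is picked inside [Q]. For a prime ideal this
    gives finitely many generators modulo [m]. *)
Lemma finite_mod_sub (Q : set F) m : (0 < m)%N -> Q `<=` A ->
  exists2 T : seq F, forall t, t \in T -> Q t &
    forall a, Q a -> exists2 t, t \in T & exists2 b, A b & a = t + m%:R * b.
Proof.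
move=> m0 QA; have [T AT HT] := finite_mod_gt0 m0.
suff [T' QT' HT'] : exists2 T' : seq F, forall t, t \in T' -> Q t &
    forall a t, Q a -> t \in T -> (exists2 b, A b & a = t + m%:R * b) ->
    exists2 t, t \in T' & exists2 b, A b & a = t + m%:R * b.
  exists T' => // a Qa; have [t tT h] := HT a (QA _ Qa).
  exact: HT' tT h.
elim: (T) => [|t0 S [T' QT' HT']]; first by exists [::].
have [[q Qq [c Ac qE]]|nq] :=
  pselect (exists2 q, Q q & exists2 c, A c & q = t0 + m%:R * c); last first.
  exists T' => // a t Qa; rewrite inE => /orP [/eqP -> [b Ab aE]|]; last exact: HT'.
  by case: nq; exists a => //; exists b.
exists (q :: T').
  by move=> t; rewrite inE => /orP [/eqP -> //|]; exact: QT'.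
move=> a t Qa; rewrite inE => /orP [/eqP -> [b Ab ->]|tS /(HT' a t Qa tS)].
  exists q; first exact: mem_head.
  by exists (b - c); [exact: roiB | rewrite qE; ring].
by move=> [t' t'T' h]; exists t' => //; rewrite inE t'T' orbT.
Qed.

Lemma roi_pigeonhole m (f : nat -> F) : (0 < m)%N -> (forall k, A (f k)) ->
  exists i j, (i < j)%N /\ exists2 b, A b & f j - f i = m%:R * b.
Proof.
move=> m0 Af; have [T _ HT] := finite_mod_gt0 m0.
have /choice [g gP] k : exists t, t \in T /\ exists2 b, A b & f k = t + m%:R * b.
  by have [t tT [b Ab e]] := HT _ (Af k); exists t; split => //; exists b.
have ninj : ~ uniq (map g (iota 0 (size T).+1)).
  move=> u; have /(uniq_leq_size u) : {subset map g (iota 0 (size T).+1) <= T}.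
    by move=> t /mapP [k _ ->]; case: (gP k).
  by rewrite size_map size_iota ltnn.
have [i [j [lij gij]]] : exists i j, (i < j)%N /\ g i = g j.
  apply: contrapT => nex; apply: ninj; rewrite map_inj_uniq ?iota_uniq //.
  move=> i j gij; case: (ltngtP i j) => // lij; case: nex.
    by exists i, j.
  by exists j, i.
exists i, j; split => //.
have [[_ [b Ab ->]] [_ [c Ac ->]]] := (gP i, gP j).
by exists (c - b); [exact: roiB | rewrite gij; ring].
Qed.

(** Two of the elements [m%:R * x ^+ k] are congruent modulo [m]; dividing their difference by [m]
    shows [x ^+ j - x ^+ i] to be integral. *)
Lemma roi_almost_integral m x : (0 < m)%N -> (forall k, A (m%:R * x ^+ k)) -> A x.
Proof.
move=> m0 /(roi_pigeonhole m0) [i [j [lij [b Ab e]]]].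
apply: (roi_expr_sub lij); suff -> : x ^+ j - x ^+ i = b by [].
by apply: (mulfI (natf_neq0_id m0)); rewrite mulrBr.
Qed.

(** * Prime ideals and their localizations *)

Definition roi_ideal (I : set F) : Prop :=
  [/\ I `<=` A, forall x y, I x -> I y -> I (x + y) &
      forall a x, A a -> I x -> I (a * x)].

Definition roi_prime (P : set F) : Prop :=
  [/\ roi_ideal P, ~ P 1 & forall x y, A x -> A y -> P (x * y) -> P x \/ P y].

(** Among the proper ideals above [J], one is taken that contains the most elements of a finite
    system of representatives modulo [m]. As [m] lies in it, adjoining an integer outside it would
    add at least one representative. *)
Lemma roi_maximal (J : set F) m : (0 < m)%N -> roi_ideal J -> J m%:R -> ~ J 1 ->
  exists2 P, roi_prime P & J `<=` P.
Proof.
move=> m0 idJ Jm J1; have [T AT HT] := finite_mod_gt0 m0.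
pose cnt (I : set F) := count (fun t => `[< I t >]) T.
pose Q k := `[< exists I, [/\ roi_ideal I, J `<=` I, ~ I 1 & cnt I = k] >].
have exQ : exists k, Q k by exists (cnt J); rewrite /Q; apply/asboolP; exists J; split.
have bQ k : Q k -> (k <= size T)%N.
  by rewrite /Q => /asboolP [I [_ _ _ <-]]; exact: count_size.
case: (ex_maxnP exQ bQ) => k /asboolP [P [idP JP P1 cP]] maxk.
exists P; last exact: JP.
split; [exact: idP | exact: P1 | move=> x y Ax Ay Pxy].
apply: contrapT => /not_orP [nPx nPy].
have [PA PD PM] := idP.
pose I := [set z | exists p a, [/\ P p, A a & z = p + a * x]].
have PI : P `<=` I by move=> p Pp; exists p, 0; rewrite mul0r addr0; split => //; exact: roi0.
have idI : roi_ideal I.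
  split.
  - by move=> _ [p [a [Pp Aa ->]]]; apply: roiD; [exact: PA | exact: roiM].
  - move=> _ _ [p [a [Pp Aa ->]]] [p' [a' [Pp' Aa' ->]]].
    exists (p + p'), (a + a'); split; [exact: PD | exact: roiD | ring].
  - move=> c _ Ac [p [a [Pp Aa ->]]].
    exists (c * p), (c * a); split; [exact: PM | exact: roiM | ring].
have P0 : P 0 by rewrite -(mul0r m%:R); apply: PM; [exact: roi0 | exact: JP].
have Ix : I x by exists 0, 1; split=> //; [exact: roi1 | rewrite mul1r add0r].
(* If [1 = p + a * x], multiplying by [y] puts [y] in [P]. Otherwise [I] competes with [P], and the
   representative [t] of [x] lies in [I] but not in [P]. *)
have [I1|nI1] := pselect (I 1).
  case: I1 => p [a [Pp Aa e]]; apply: nPy.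
  have -> : y = y * p + a * (x * y) by rewrite -[LHS]mulr1 e; ring.
  by apply: PD; apply: PM.
have : Q (cnt I) by rewrite /Q; apply/asboolP; exists I; split=> // z /JP /PI.
move=> /maxk; rewrite -cP leqNgt => /negP; apply.
have [t tT [b Ab xE]] := HT x Ax.
have Pmb : P (m%:R * b) by rewrite mulrC; apply: PM => //; exact: JP.
have nPt : ~ P t by move=> Pt; apply: nPx; rewrite xE; exact: PD.
have It : I t.
  have -> : t = x + (-1) * (m%:R * b) by rewrite xE; ring.
  have [_ ID IM] := idI; apply: (ID) => //; apply: (IM); last exact: PI.
  exact/roiN/roi1.
rewrite /cnt; elim: (T) tT => // t' S IH; rewrite inE /= => /orP [/eqP <-|tS].
  rewrite asboolF // asboolT // add0n add1n ltnS.
  by apply: sub_count => z /asboolP Pz; apply/asboolP/PI.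
apply: leq_trans (leq_add (leqnn _) (IH tS)); rewrite -addnS leq_add2r.
by case: asboolP => // /PI It'; rewrite asboolT.
Qed.

Section Prime.
Variables (P : set F) (m : nat).
Hypotheses (prP : roi_prime P) (m0 : (0 < m)%N) (Pm : P m%:R).

Let idP : roi_ideal P. Proof. by case: prP. Qed.
Let PA : P `<=` A. Proof. by case: idP. Qed.
Let PD x y : P x -> P y -> P (x + y). Proof. by case: idP => _ + _; exact. Qed.
Let PM a x : A a -> P x -> P (a * x). Proof. by case: idP => _ _; exact. Qed.
Let P1 : ~ P 1. Proof. by case: prP. Qed.
Let nPM x y : A x -> A y -> ~ P x -> ~ P y -> ~ P (x * y).
Proof. by move=> Ax Ay nx ny; case: prP => _ _ h /h []. Qed.
Let nPX x k : A x -> ~ P x -> ~ P (x ^+ k).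
Proof.
move=> Ax nx; elim: k => [|k IH]; first by rewrite expr0.
by rewrite exprS; apply: nPM => //; exact: roiX.
Qed.

(* Multiplying [c = 1] by elements outside [P] and by powers of the [y] in turn
   keeps the annihilator of [c] modulo [m] inside [P], until [c] kills each [y]. *)
Lemma annihilator_of_prime (Y : seq F) : (forall y, y \in Y -> P y) ->
  exists c, [/\ A c, forall z, A z -> (exists2 b, A b & z * c = m%:R * b) -> P z &
    forall y, y \in Y -> exists2 b, A b & c * y = m%:R * b].
Proof.
elim: Y => [_|y Y IH PY].
  exists 1; split; [exact: roi1 | | by move=> y; rewrite in_nil].
  by move=> z Az [b Ab]; rewrite mulr1 => ->; rewrite mulrC; exact: PM.
have [|c [Ac goodc cY]] := IH; first by move=> z zY; apply: PY; rewrite inE zY orbT.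
have Py : P y by apply: PY; exact: mem_head.
have Ay := PA Py.
pose good k := forall z, A z -> (exists2 b, A b & z * (c * y ^+ k) = m%:R * b) -> P z.
have [k [gk ngk]] : exists k, good k /\ ~ good k.+1.
  apply: contrapT => nex.
  have allg k : good k.
    elim: k => [|k IHk]; first by move=> z; rewrite expr0 mulr1; exact: goodc.
    by apply: contrapT => ng; apply: nex; exists k.
  (* If all powers were good, two congruent powers of [y] would put [1 - y ^+ (j - i)] in [P], and
     with it 1. *)
  have [i [j [lij [b Ab e]]]] := roi_pigeonhole m0 (fun k => roiX k Ay).
  apply: P1; rewrite -(subrK (y ^+ (j - i)) 1); apply: PD.
    apply: (allg i); first by apply: roiB; [exact: roi1 | exact: roiX].
    exists (- c * b); first by apply: roiM => //; exact: roiN.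
    have {}e : y ^+ i = y ^+ j - m%:R * b by rewrite -e; ring.
    have ej : y ^+ j = y ^+ (j - i) * y ^+ i by rewrite -exprD subnK // ltnW.
    by rewrite mulrBl mulrCA [y ^+ (j - i) * _]mulrCA -ej mul1r {1}e; ring.
  rewrite -(subnSK lij) exprSr; apply: PM => //; exact: roiX.
(* The failure at [k.+1] supplies [z] outside [P]; the new [c] is [z * (c * y ^+ k)], which kills
   [y] modulo [m]. *)
have [z [Az nPz [b Ab zE]]] : exists z, [/\ A z, ~ P z &
    exists2 b, A b & z * (c * y ^+ k.+1) = m%:R * b].
  by apply: contrapT => nex; apply: ngk => z Az h; apply: contrapT => nPz;
     apply: nex; exists z.
exists (z * (c * y ^+ k)); split.
- by do 2![apply: roiM => //]; exact: roiX.
- move=> w Aw [b' Ab' e]; apply: contrapT => nPw.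
  apply: (nPM Aw Az nPw nPz); apply: gk; first exact: roiM.
  by exists b' => //; rewrite -e !mulrA.
move=> y'; rewrite inE => /orP [/eqP ->|/cY [b' Ab' e]].
  by exists b => //; rewrite -zE exprSr !mulrA.
exists (z * y ^+ k * b'); first by do 2![apply: roiM => //]; exact: roiX.
have -> : z * (c * y ^+ k) * y' = z * y ^+ k * (c * y') by ring.
by rewrite e; ring.
Qed.

(** Take [theta = c / m] with [c] killing modulo [m] the finitely many generators of [P] modulo [m].
    Were [theta] integral, 1 would annihilate [c] modulo [m] and so lie in [P]. *)
Lemma prime_inverse : exists theta, ~ A theta /\ forall p, P p -> A (theta * p).
Proof.
have [Y PY HY] := finite_mod_sub m0 PA.
have [c [Ac good cY]] := annihilator_of_prime PY.
have mn0 := natf_neq0_id m0.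
exists (c / m%:R); split.
  move=> At; apply: P1; apply: good; first exact: roi1.
  by exists (c / m%:R) => //; rewrite mul1r mulrC divfK.
move=> p /HY [y /cY [b Ab e] [b' Ab' ->]].
have -> : c / m%:R * (y + m%:R * b') = b + c * b'; last first.
  by apply: roiD => //; exact: roiM.
by rewrite mulrDr mulrA divfK // mulrAC e [m%:R * b]mulrC mulfK.
Qed.

Lemma prime_uniformizer : exists theta p,
  [/\ P p, A (theta * p), ~ P (theta * p) & forall q, P q -> A (theta * q)] /\ ~ A theta.
Proof.
have [theta [nA tP]] := prime_inverse; exists theta.
have [p [Pp nPt]] : exists p, P p /\ ~ P (theta * p).
  apply: contrapT => nex; apply: nA; apply: (roi_almost_integral m0) => k.
  apply: PA; elim: k => [|k IH]; first by rewrite expr0 mulr1.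
  apply: contrapT => nP; apply: nex; exists (m%:R * theta ^+ k); split => //.
  by rewrite mulrCA -exprS.
by exists p; split=> //; split=> //; exact: tP.
Qed.

Definition roi_loc : set F := [set x | exists s, [/\ A s, ~ P s & A (s * x)]].

Lemma roi_locA a : A a -> roi_loc a.
Proof. by move=> Aa; exists 1; rewrite mul1r; split=> //; exact: roi1. Qed.

Lemma roi_locM x y : roi_loc x -> roi_loc y -> roi_loc (x * y).
Proof.
move=> [s [As nPs Asx]] [t [At nPt Aty]]; exists (s * t).
by split; [exact: roiM | exact: nPM | rewrite mulrACA; exact: roiM].
Qed.

Lemma roi_locD x y : roi_loc x -> roi_loc y -> roi_loc (x + y).
Proof.
move=> [s [As nPs Asx]] [t [At nPt Aty]]; exists (s * t).
split; [exact: roiM | exact: nPM |].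
have -> : s * t * (x + y) = t * (s * x) + s * (t * y) by ring.
by apply: roiD; exact: roiM.
Qed.

Lemma roi_locV s : A s -> ~ P s -> roi_loc s^-1.
Proof.
move=> As nPs; exists s; split=> //; have [->|s0] := eqVneq s 0.
  by rewrite mul0r; exact: roi0.
by rewrite divff //; exact: roi1.
Qed.

Lemma roi_loc_uniformizer : exists pi, [/\ pi != 0, P pi, ~ roi_loc pi^-1 &
  forall x, x != 0 -> exists (k : int) u,
    [/\ roi_loc u, roi_loc u^-1 & x = u * pi ^ k]].
Proof.
have [theta [p [[Pp Atp nPtp tP] nAt]]] := prime_uniformizer.
have P0 : P 0 by rewrite -(mul0r m%:R); apply: PM => //; exact: roi0.
have tp0 : theta * p != 0 by apply/eqP => e; apply: nPtp; rewrite e.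
have [t0 p0] : theta != 0 /\ p != 0 by apply/andP; rewrite -negb_or -mulf_eq0.
have Aexp a : A a -> a != 0 -> exists (k : int) u,
    [/\ roi_loc u, roi_loc u^-1 & a = u * p ^ k].
  move=> Aa a0; have [k [Ak nPk]] : exists k, A (a * theta ^+ k) /\ ~ P (a * theta ^+ k).
    apply: contrapT => nex.
    (* If the process never stopped, every [a * theta ^+ k] would be integral. A multiple [N] of [a]
       would then be a common denominator of the powers of [theta], which is not integral. *)
    have allA k : A (a * theta ^+ k).
      elim: k => [|k IH]; first by rewrite expr0 mulr1.
      rewrite exprS mulrCA; apply: tP; apply: contrapT => nP; apply: nex.
      by exists k.
    have [N N0 [b Ab ab]] := roi_dvd_nat Aa a0.
    apply: nAt; apply: (roi_almost_integral N0) => k.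
    by rewrite -ab mulrAC mulrC; exact: roiM.
  exists k%:Z, (a * theta ^+ k / (theta * p) ^+ k); split.
  - by apply: roi_locM; [exact: roi_locA | apply: roi_locV; [exact: roiX | exact: nPX]].
  - rewrite invf_div; apply: roi_locM; [exact/roi_locA/roiX | exact: roi_locV].
  - by rewrite exprMn -exprnP; field; rewrite !expf_neq0.
exists p; split => //.
- by move=> [s [As nPs Asp]]; apply: nPs; rewrite -(divfK p0 s); exact: PM.
(* A general [x] is the quotient of the integers [N%:R * x] and [N%:R]. *)
- move=> x x0; have [N N0 ANx] := roi_denom x.
  have Nn0 := natf_neq0_id N0.
  have [k [u [Vu Vu1 uE]]] := Aexp _ ANx (mulf_neq0 Nn0 x0).
  have [l [v [Vv Vv1 vE]]] := Aexp _ (roi_nat F N) Nn0.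
  exists (k - l), (u / v); split; [exact: roi_locM | |].
    by rewrite invf_div; exact: roi_locM.
  have /mulfI : N%:R != 0 :> F by []. apply.
  rewrite uE {1}vE.
  have v0 : v != 0 by apply: contraNneq Nn0 => v0; rewrite vE v0 mul0r.
  have -> : v * p ^ l * (u / v * p ^ (k - l)) = u * (p ^ (k - l) * p ^ l).
    by field.
  by rewrite -expfzDr // subrK.
Qed.

End Prime.

End NumberField.

(** * Finite places *)

Section PlaceOfUniformizer.
Variables (R : realType) (F : fieldType) (V : set F) (pi : F).
Hypotheses (V1 : V 1) (VN1 : V (-1)) (Vpi : V pi) (nVpi : ~ V pi^-1) (pi0 : pi != 0).
Hypothesis VD : forall x y, V x -> V y -> V (x + y).
Hypothesis VM : forall x y, V x -> V y -> V (x * y).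
Hypothesis Vpi_exp : forall x, x != 0 -> exists (k : int) u,
  [/\ V u, V u^-1 & x = u * pi ^ k].

Let V_pi_exp (k : nat) : V (pi ^+ k).
Proof. by elim: k => [|k IH]; rewrite ?expr0 // exprS; exact: VM. Qed.

Let V_piz (k : int) : V (pi ^ k) <-> 0 <= k.
Proof.
case: k => k; split => //; first by rewrite -exprnP.
rewrite NegzE -exprnN => h; case: nVpi.
have -> : pi^-1 = pi ^- k.+1 * pi ^+ k by rewrite exprS; field; rewrite expf_neq0.
exact: VM.
Qed.

Let two_neq0 : 2 != 0 :> R. Proof. by rewrite pnatr_eq0. Qed.

(** The exponent of [pi] in [x] is unique because [pi ^ k] lies in [V] only for [0 <= k]; the place
    is 2 to the opposite of this exponent. *)
Lemma place_of_uniformizer : exists w : place R F,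
  [/\ finite_place w, forall x, w x <= 1 <-> V x & w pi = 2^-1].
Proof.
(* The value of [ord] at 0 is arbitrary, as [abs] treats 0 apart. *)
have /choice [ord ordP] x : exists k : int, x != 0 ->
    exists u, [/\ V u, V u^-1 & x = u * pi ^ k].
  have [->|x0] := eqVneq x 0; first by exists 0.
  by have [k [u h]] := Vpi_exp x0; exists k => _; exists u.
have pin0 k : pi ^ k != 0 by rewrite expfz_neq0.
have ordV x : x != 0 -> (V x <-> 0 <= ord x).
  move=> x0; have [u [Vu Vu1 xE]] := ordP x x0; rewrite {1}xE.
  have u0 : u != 0 by apply: contraNneq x0 => u0; rewrite xE u0 mul0r.
  split => [h|/V_piz]; last exact: VM.
  by apply/V_piz; rewrite -(mulKf u0 (pi ^ _)); exact: VM.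
have ord_uniq x k u : V u -> V u^-1 -> x != 0 -> x = u * pi ^ k -> ord x = k.
  move=> Vu Vu1 x0 xE; have [v [Vv Vv1 xE']] := ordP x x0.
  have u0 : u != 0 by apply: contraNneq x0 => u0; rewrite xE u0 mul0r.
  have v0 : v != 0 by apply: contraNneq x0 => v0; rewrite xE' v0 mul0r.
  have e : u * pi ^ k = v * pi ^ (ord x) by rewrite -xE -xE'.
  apply/eqP; rewrite eq_le -[_ <= k]subr_ge0 -[k <= _]subr_ge0.
  apply/andP; split; apply/V_piz; rewrite expfzDr // -invr_expz.
    have -> : pi ^ k / pi ^ ord x = v * u^-1 by field: e; rewrite ?u0 ?pin0.
    exact: VM.
  have -> : pi ^ ord x / pi ^ k = u * v^-1 by field: e; rewrite ?v0 ?pin0.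
  exact: VM.
have ordM x y : x != 0 -> y != 0 -> ord (x * y) = ord x + ord y.
  move=> x0 y0; have [u [Vu Vu1 xE]] := ordP x x0.
  have [v [Vv Vv1 yE]] := ordP y y0.
  apply: (@ord_uniq _ _ (u * v)); first exact: VM.
  - by rewrite invfM; exact: VM.
  - exact: mulf_neq0.
  - by rewrite {1}xE {1}yE expfzDr // mulrACA.
have ordpi k : ord (pi ^ k) = k.
  by apply: (@ord_uniq _ _ 1) => //; rewrite ?invr1 // mul1r.
pose abs x : R := if x == 0 then 0 else 2 ^ (- ord x).
have absE x : x != 0 -> abs x = 2 ^ (- ord x) by rewrite /abs => /negPf ->.
have abs0 : abs 0 = 0 by rewrite /abs eqxx.
have gt0 k : 0 < (2 : R) ^ k by rewrite exprz_gt0.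
have abs_ge0 x : 0 <= abs x by rewrite /abs; case: ifP => // _; exact: ltW.
have absM x y : abs (x * y) = abs x * abs y.
  have [->|x0] := eqVneq x 0; first by rewrite mul0r abs0 mul0r.
  have [->|y0] := eqVneq y 0; first by rewrite mulr0 abs0 mulr0.
  by rewrite !absE ?mulf_neq0 // ordM // opprD expfzDr.
have absV x : abs x <= 1 <-> V x.
  have [->|x0] := eqVneq x 0.
    rewrite abs0 ler01; split => // _.
    by rewrite -(subrr 1); apply: VD.
  rewrite absE // ordV // -[X in _ <= X](expr0z (2 : R)).
  by rewrite ler_eXz2l ?ltr1n // oppr_le0.
have abspi : abs pi = 2^-1 by rewrite absE // -[in ord pi](expr1z pi) ordpi.
have abs1 : abs 1 = 1.
  by rewrite absE ?oner_neq0 // (_ : ord 1 = 0) ?oppr0 ?expr0z // -(ordpi 0) expr0z.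
(* After division by [y] this says that [V] is closed under adding 1. *)
have le1D x y : abs x <= abs y -> abs (x + y) <= abs y.
  have [->|y0] := eqVneq y 0.
    move=> h; have [->|x0] := eqVneq x 0; first by rewrite addr0.
    by move: h; rewrite abs0 absE // leNgt gt0.
  have ay : 0 < abs y by rewrite absE.
  have h z : (abs (z / y) <= 1) = (abs z <= abs y).
    rewrite absM; have -> : abs y^-1 = (abs y)^-1.
      by apply: (mulfI (lt0r_neq0 ay)); rewrite -absM !divff ?abs1 // gt_eqF.
    by rewrite ler_pdivrMr // mul1r.
  rewrite -!h => /absV Vxy; apply/absV; rewrite mulrDl divff //.
  exact: VD.
have um x y : abs (x + y) <= Num.max (abs x) (abs y).
  by case: (leP (abs x) (abs y)) => [/le1D //|/ltW /le1D]; rewrite addrC.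
have absA : absolute_value abs.
  split=> //.
  - move=> x; rewrite /abs; case: ifP => h; first by rewrite eqxx.
    by rewrite gt_eqF.
  - move=> x y; apply: le_trans (um x y) _.
    by rewrite ge_max lerDl lerDr !abs_ge0.
have absF : is_finite_abs abs.
  split=> //; apply/seteqP; split.
    by move=> _ [x /= x0 <-]; exists (- ord x); rewrite // absE.
  by move=> _ [k _ <-]; exists (pi ^ (- k)) => //=; rewrite absE // ordpi opprK.
by exists (Place absA (or_introl absF)).
Qed.

End PlaceOfUniformizer.

Section PrimePlace.
Variables (R : realType) (F : fieldType) (hF : int_dependent F).
Local Notation A := (@ring_of_integers F).

Lemma prime_place (P : set F) m : roi_prime P -> (0 < m)%N -> P m%:R ->
  exists w : place R F, [/\ finite_place w, forall x, w x <= 1 <-> roi_loc P x &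
    forall x, P x -> w x < 1].
Proof.
move=> prP m0 Pm; have [pi [pi0 Ppi nVpi Vexp]] := roi_loc_uniformizer hF prP m0 Pm.
have [[PA PD PM] P1 _] := prP.
have [w [finw wV wpi]] := @place_of_uniformizer R F (roi_loc P) pi
  (roi_locA prP (roi1 F)) (roi_locA prP (roiN (roi1 F))) (roi_locA prP (PA _ Ppi))
  nVpi pi0 (@roi_locD _ _ prP) (@roi_locM _ _ prP) Vexp.
exists w; split => // x Px.
have [w0 w1 wM _] := pabs_abs w.
(* Otherwise [x^-1] lies in the localization, with some denominator [s] outside [P]; but
   [s = (s / x) * x] is in [P]. *)
rewrite ltNge; apply/negP => le1.
have x0 : x != 0 by rewrite -w1 gt_eqF // (lt_le_trans ltr01).
have : w x^-1 <= 1.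
  have -> : w x^-1 = (w x)^-1.
    have wx0 : w x != 0 by rewrite w1.
    apply: (mulfI wx0); rewrite -wM !divff //.
    have e : w 1 * w 1 = w 1 by rewrite -wM mulr1.
    by apply: (@mulfI _ (w 1)); rewrite ?w1 ?oner_neq0 // e mulr1.
  by rewrite invf_le1 // (lt_le_trans ltr01).
move=> /wV [s [As nPs Asx]]; apply: nPs.
by rewrite -(divfK x0 s); exact: PM.
Qed.

End PrimePlace.

(** * Absolute values and the valuation at a finite place *)

Section AbsoluteValue.
Variables (R : realType) (F : fieldType) (f : F -> R).
Hypothesis af : absolute_value f.

Lemma absv_ge0 x : 0 <= f x. Proof. by case: af. Qed.
Lemma absv_eq0 x : (f x == 0) = (x == 0). Proof. by case: af. Qed.
Lemma absv0 : f 0 = 0. Proof. by apply/eqP; rewrite absv_eq0. Qed.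
Lemma absv_gt0 x : (0 < f x) = (x != 0).
Proof. by rewrite lt_def absv_ge0 andbT absv_eq0. Qed.
Lemma absvM x y : f (x * y) = f x * f y. Proof. by case: af. Qed.
Lemma absvD x y : f (x + y) <= f x + f y. Proof. by case: af. Qed.

Lemma absv1 : f 1 = 1.
Proof.
have f1 : f 1 != 0 by rewrite absv_eq0 oner_neq0.
by apply: (mulfI f1); rewrite -absvM !mulr1.
Qed.

Lemma absvX x k : f (x ^+ k) = f x ^+ k.
Proof. by elim: k => [|k IH]; rewrite ?absv1 // !exprS absvM IH. Qed.

Lemma absvN x : f (- x) = f x.
Proof.
have : f (-1) ^+ 2 = 1 by rewrite -absvX sqrrN expr1n absv1.
move=> /eqP; rewrite sqrf_eq1 => /orP [] /eqP e.
  by rewrite -mulN1r absvM e mul1r.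
by move: (absv_ge0 (-1)); rewrite e lerNr oppr0 ler10.
Qed.

Lemma absvB x y : f (x - y) = f (y - x).
Proof. by rewrite -absvN opprB. Qed.

Lemma absvV x : f x^-1 = (f x)^-1.
Proof.
have [->|x0] := eqVneq x 0; first by rewrite invr0 absv0 invr0.
have fx0 : f x != 0 by rewrite absv_eq0.
by apply: (mulfI fx0); rewrite -absvM !divff ?absv1.
Qed.

Lemma absvXz x (k : int) : f (x ^ k) = f x ^ k.
Proof. by case: k => k; rewrite ?NegzE -?exprnN ?absvV absvX. Qed.

Lemma absv_sum (I : Type) (r : seq I) (g : I -> F) :
  f (\sum_(i <- r) g i) <= \sum_(i <- r) f (g i).
Proof.
elim/big_rec2: _ => [|i x y _ h]; first by rewrite absv0.
by apply: le_trans (absvD _ _) _; rewrite lerD2l.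
Qed.

End AbsoluteValue.

Section FinitePlace.
Variables (R : realType) (F : fieldType) (v : place R F).
Hypothesis fv : finite_place v.
Let av := pabs_abs v.

Lemma place_max x y : v (x + y) <= Num.max (v x) (v y).
Proof. by case: fv. Qed.

Lemma place_leD x y M : v x <= M -> v y <= M -> v (x + y) <= M.
Proof. by move=> h1 h2; apply: le_trans (place_max x y) _; rewrite ge_max h1. Qed.

Lemma place_ltD x y M : v x < M -> v y < M -> v (x + y) < M.
Proof. by move=> h1 h2; apply: le_lt_trans (place_max x y) _; rewrite gt_max h1. Qed.

Lemma place_le_sum (I : Type) (r : seq I) (Q : pred I) (g : I -> F) M : 0 <= M ->
  (forall i, Q i -> v (g i) <= M) -> v (\sum_(i <- r | Q i) g i) <= M.
Proof.
move=> M0 h; apply: (big_ind (fun x => v x <= M)) => //.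
  by rewrite absv0.
by move=> x y; exact: place_leD.
Qed.

Lemma place_nat_le1 k : v k%:R <= 1.
Proof.
elim: k => [|k IH]; first by rewrite absv0.
by rewrite -natr1; apply: place_leD; rewrite ?absv1.
Qed.

Lemma place_int_le1 (z : int) : v z%:~R <= 1.
Proof.
by case: z => k; rewrite ?NegzE ?mulrNz ?absvN // -pmulrn place_nat_le1.
Qed.

Lemma place_exp2 x : x != 0 -> exists k : int, v x = 2 ^ k.
Proof.
move=> x0; have [_ /seteqP [h _]] := fv.
by have [|k _ <-] := h (v x); [exists x | exists k].
Qed.

Lemma place_uniformizer : exists2 x, x != 0 & v x = 2^-1.
Proof.
have [_ /seteqP [_ h]] := fv.
by have [|x x0 e] := h 2^-1; [exists (-1) | exists x].
Qed.

(** The nonzero values are powers of 2, so a strict inequality gains a factor 2. *)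
Lemma place_lt_exp2 x (k : int) : v x < 2 ^ k -> v x <= 2 ^ (k - 1).
Proof.
have [->|/place_exp2 [l ->]] := eqVneq x 0.
  by rewrite absv0 // => _; rewrite exprz_ge0.
by rewrite ltr_eXz2l ?ler_eXz2l ?ltr1n //; lia.
Qed.

(** If [1 < v x], the leading term of a monic integral equation of [x] would exceed all the
    others. *)
Lemma place_roi_le1 x : @ring_of_integers F x -> v x <= 1.
Proof.
move=> [p mp /rootP px]; rewrite leNgt; apply/negP => x1.
have mq : map_poly intr p \is @monic F by exact: monic_map.
set q := map_poly intr p in px mq.
have [d sz] : exists d, size q = d.+1.
  by exists (size q).-1; rewrite prednK // size_poly_gt0 monic_neq0.
move: px; rewrite horner_coef sz big_ord_recr /= -[q`_d](_ : lead_coef q = _); last first.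
  by rewrite lead_coefE sz.
rewrite (monicP mq) mul1r addrC => /eqP; rewrite addr_eq0 => /eqP e.
have : v (x ^+ d) <= v x ^+ d.-1.
  rewrite e absvN //; apply: place_le_sum => [|i _]; first by rewrite exprn_ge0 ?absv_ge0.
  rewrite absvM // coef_map /= absvX // -[X in _ <= X]mul1r.
  apply: ler_pM; rewrite ?place_int_le1 ?exprn_ge0 ?absv_ge0 //.
  by apply: ler_weXn2l; [exact: ltW | case: (d) i => [[]|d'] // i; rewrite -ltnS].
case: (d) e => [|d' _].
  rewrite expr0 big_ord0 oppr0 => e; move: (oner_neq0 F); by rewrite e eqxx.
by rewrite absvX //= leNgt ltr_eXn2l ?ltnSn.
Qed.

End FinitePlace.

(** * Orders and the local-global principle *)

Section Lattices.
Variables (F : fieldType) (A : set F).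

(** Coefficients indexed by [nat] do not depend on [size s], which can then be rewritten when [s] is
    the image of another sequence. *)
Lemma lattice_spanP (V : lmodType F) (s : seq V) x : A 0 ->
  lattice_span A s x <-> exists2 c : nat -> F, forall i, A (c i) &
    x = \sum_(0 <= i < size s) c i *: s`_i.
Proof.
move=> A0; split=> [[c Ac ->]|[c Ac ->]].
  exists (fun i => oapp c 0 (insub i)).
    by move=> i; case: insubP => [j _ _|_] /=.
  rewrite big_mkord; apply: eq_bigr => i _; by rewrite valK.
by exists (fun i => c i) => //; rewrite big_mkord.
Qed.

Hypotheses (A0 : A 0) (A1 : A 1) (AD : forall x y, A x -> A y -> A (x + y))
  (AM : forall x y, A x -> A y -> A (x * y)).

Lemma lattice_spanD (V : lmodType F) (s : seq V) x y :
  lattice_span A s x -> lattice_span A s y -> lattice_span A s (x + y).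
Proof.
move=> [c Ac ->] [d Ad ->]; exists (fun i => c i + d i).
  by move=> i; exact: AD.
by rewrite -big_split; apply: eq_bigr => i _; rewrite scalerDl.
Qed.

Lemma lattice_spanZ (V : lmodType F) (s : seq V) a x :
  A a -> lattice_span A s x -> lattice_span A s (a *: x).
Proof.
move=> Aa [c Ac ->]; exists (fun i => a * c i).
  by move=> i; exact: AM.
by rewrite scaler_sumr; apply: eq_bigr => i _; rewrite scalerA.
Qed.

Lemma lattice_span_nth (V : lmodType F) (s : seq V) i : (i < size s)%N ->
  lattice_span A s s`_i.
Proof.
move=> lis; exists (fun j : 'I_(size s) => (i == j :> nat)%:R) => [j|].
  by case: eqP.
rewrite (bigD1 (Ordinal lis)) //= eqxx scale1r big1 ?addr0 // => j.
by rewrite -val_eqE /= eq_sym => /negPf ->; rewrite scale0r.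
Qed.

Variables (V : falgType F) (D : set V).
Hypothesis oD : is_order A D.

Lemma is_orderD x y : D x -> D y -> D (x + y).
Proof. by case: oD => _ _ [s _ ->]; exact: lattice_spanD. Qed.

Lemma is_orderZ a x : A a -> D x -> D (a *: x).
Proof. by case: oD => _ _ [s _ ->]; exact: lattice_spanZ. Qed.

Lemma is_order0 : D 0.
Proof. by rewrite -(scale0r 1); apply: is_orderZ => //; case: oD. Qed.

End Lattices.

Section LocalGlobal.
Variables (R : realType) (K : fieldType) (B : falgType K) (n : nat).
Hypothesis hK : int_dependent K.
Local Notation A := (@ring_of_integers K).
Variable D : set B.
Hypothesis oD : is_order A D.
Let DD := is_orderD (@roiD K) oD.
Let DZ := is_orderZ (@roiM K) oD.
Let D0 := is_order0 (@roi0 K) (@roiM K) oD.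

Lemma order_denom (x : B) : exists2 m, (0 < m)%N & D (m%:R *: x).
Proof.
have [D1 _ [s spanS DE]] := oD.
have : x \in <<s>>%VS by rewrite spanS memvf.
move=> /(coord_span (X := in_tuple s)) ->; set c := coord _.
have : forall r : seq 'I_(size s), exists2 m, (0 < m)%N &
    D (m%:R *: \sum_(i <- r) c i x *: s`_i).
  elim=> [|i r [m m0 Dm]].
    by exists 1%N => //; rewrite big_nil scaler0.
  have [d d0 Ad] := roi_denom hK (c i x); exists (d * m)%N; first by rewrite muln_gt0 d0.
  rewrite big_cons scalerDr natrM; apply: DD.
    have -> : (d%:R * m%:R) *: (c i x *: s`_i) = m%:R *: ((d%:R * c i x) *: s`_i).
      by rewrite !scalerA; congr (_ *: _); ring.
    apply: (DZ (roi_nat K m)).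
    by apply: DZ => //; rewrite DE; exact: (lattice_span_nth (roi0 K) (roi1 K)).
  by rewrite -scalerA; apply: DZ => //; exact: roi_nat.
exact.
Qed.

Lemma order_sub_localize (v : place R K) (l : localization B n v) x :
  D x -> localize l D (locB l x).
Proof.
move=> Dx fv; exists [:: x]; split.
  by move=> y /=; rewrite inE => /eqP ->.
have [al _ _ _] := loc_completion l.
by apply: (@lattice_span_nth _ _ _ _ _ [:: locB l x] 0%N) => //;
  rewrite /loc_integers /= ?absv0 ?absv1.
Qed.

(* Approximating the coefficients by elements of [K] leaves an element of [B]
   with small coordinates. *)
Lemma localize_descent (v : place R K) (l : localization B n v) (M : set B) y :
  finite_place v -> localize l D (locB l y) ->
  D `<=` M -> (forall x z, M x -> M z -> M (x + z)) ->
  (forall a x, v a <= 1 -> M x -> M (a *: x)) -> M y.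
Proof.
have [al aloci dense _] := loc_completion l.
have A0 : loc_integers l 0 by rewrite /loc_integers /= (absv0 al).
move=> fv /(_ fv) [t [tD /(lattice_spanP _ _ A0) [c Ac yE]]] DM MD MZ.
have av := pabs_abs v.
rewrite size_map in yE.
pose e := vbasis {:B}; have be : basis_of {:B} e := vbasisP _.
have eB x : x = \sum_j coord e j x *: e`_j by exact: (coord_basis be (memvf x)).
(* A common [m] carries the basis into [D], so an element whose coordinates are at most [v m%:R] is
   in [M]. *)
have [m m0 De] : exists2 m, (0 < m)%N & forall j : 'I_(\dim {:B}), D (m%:R *: e`_j).
  have /choice [md mdP] j : exists m, (0 < m)%N /\ D (m%:R *: e`_j).
    by have [m m0 Dm] := order_denom e`_j; exists m.
  exists (\prod_(j < \dim {:B}) md j)%N.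
    by rewrite prodn_gt0 // => j; case: (mdP j).
  move=> j; rewrite (bigD1 j) //= natrM mulrC -scalerA.
  by apply: DZ; [exact: roi_nat | case: (mdP j)].
have mn0 := natf_neq0_id hK m0.
pose S := \sum_(0 <= i < size t) \sum_j v (coord e j t`_i).
have S0 : 0 <= S by apply: sumr_ge0 => i _; apply: sumr_ge0 => j _; exact: absv_ge0.
(* The bound 1 keeps the approximations [k i] integral at [v]; the other one brings the coordinates
   of the error [z] below [v m%:R]. *)
pose delta := Num.min 1 (v m%:R / (S + 1)).
have S1 : 0 < S + 1 by rewrite ltr_wpDl.
have d0 : 0 < delta by rewrite lt_min ltr01 divr_gt0 // absv_gt0.
have /choice [k kP] i : exists a, locabs l (c i - loci l a) < delta by exact: dense.
(* The completion comes with the triangle inequality, which gives [v (k i) < 2]; discreteness of [v]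
   improves this to 1. *)
have k1 i : v (k i) <= 1.
  rewrite -[1](expr0z 2) -[0](addrK 1) add0r; apply: place_lt_exp2 => //.
  rewrite expr1z -aloci -(subrK (c i) (loci l _)).
  apply: le_lt_trans (absvD al _ _) _; rewrite absvB //.
  apply: (lt_le_trans (y := delta + 1)); first by rewrite ltr_leD //; exact: Ac.
  by rewrite lerD2r ge_min lexx.
pose z := y - \sum_(0 <= i < size t) k i *: t`_i.
pose X := map_tuple (locB l) e.
have fX : free X by exact: basis_free (locB_basis l).
have XE j : X`_j = locB l e`_j.
  have [jl|jl] := ltnP j (size e); first by rewrite (nth_map 0).
  by rewrite !nth_default ?size_map // rmorph0.
have locB_X x : locB l x = \sum_j loci l (coord e j x) *: X`_j.
  rewrite {1}[x]eB rmorph_sum; apply: eq_bigr => j _.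
  by rewrite locB_semilinear XE.
(* The basis of [B] stays free over the completion, so coordinates can be compared there. *)
have coordz j : loci l (coord e j z) =
    \sum_(0 <= i < size t) (c i - loci l (k i)) * loci l (coord e j t`_i).
  have : locB l z = \sum_j (\sum_(0 <= i < size t)
      (c i - loci l (k i)) * loci l (coord e j t`_i)) *: X`_j.
    under eq_bigr do rewrite scaler_suml.
    rewrite exchange_big /= rmorphB rmorph_sum yE -sumrB; apply: eq_big_nat => i ilt.
    rewrite locB_semilinear (nth_map 0) // -scalerBl locB_X scaler_sumr.
    by apply: eq_bigr => j' _; rewrite scalerA.
  rewrite locB_X => /(congr1 (coord X j)); rewrite !coord_sum_free //.
have vz j : v (coord e j z) <= v m%:R.
  rewrite -aloci coordz; apply: le_trans (absv_sum al _ _) _.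
  apply: (@le_trans _ _ (delta * S)).
    rewrite mulr_sumr !big_nat; apply: ler_sum => i _; rewrite absvM //.
    apply: ler_pM; [exact: absv_ge0 | exact: absv_ge0 | exact: ltW | rewrite aloci].
    by rewrite (bigD1 j) //= lerDl; apply: sumr_ge0 => j' _; exact: absv_ge0.
  apply: (@le_trans _ _ (v m%:R / (S + 1) * S)).
    by rewrite ler_wpM2r // ge_min lexx orbT.
  rewrite mulrAC ler_pdivrMr //; apply: ler_wpM2l; first exact: absv_ge0.
  by rewrite lerDl.
rewrite -[y](subrK (\sum_(0 <= i < size t) k i *: t`_i)) -/z.
have M0 : M 0 by apply: DM.
apply: (MD).
  rewrite [z]eB; apply: (big_ind M M0 MD) => j _.
  rewrite -[coord e j z](divfK mn0) -scalerA; apply: MZ; last exact/DM/De.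
  by rewrite absvM // absvV // ler_pdivrMr ?absv_gt0 // mul1r.
rewrite big_mkord; apply: (big_ind M M0 MD) => i _; apply: MZ => //.
by apply: DM; apply: tD => /=; exact: mem_nth.
Qed.

(** The denominators of [y] form an ideal [J]. If it were proper it would lie in a prime [P], but at
    the place of [P] the element [y] is in the localization [M] of [D], which yields a denominator
    outside [P]. *)
Lemma order_local_global (loc : forall v : place R K, localization B n v) y :
  (forall v, finite_place v -> localize (loc v) D (locB (loc v) y)) -> D y.
Proof.
move=> Dy; pose J := [set a | A a /\ D (a *: y)].
have idJ : roi_ideal J.
  split; first by move=> a [].
    move=> a b [Aa Da] [Ab Db]; split; first exact: roiD.
    by rewrite scalerDl; exact: DD.
  by move=> a b Aa [Ab Db]; split; [exact: roiM | rewrite -scalerA; exact: DZ].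
have [m m0 Dm] := order_denom y.
apply: contrapT => nDy.
have [||P prP JP] := roi_maximal hK m0 idJ.
- by split=> //; exact: roi_nat.
- by move=> [_]; rewrite scale1r.
have Pm : P m%:R by apply: JP; split=> //; exact: roi_nat.
have [v [fv vP _]] := prime_place R hK prP m0 Pm.
have [[PA _ _] P1 primeP] := prP.
pose M := [set x : B | exists a, [/\ A a, ~ P a & D (a *: x)]].
have [a [Aa nPa Da]] : M y.
  have nPM a b : A a -> A b -> ~ P a -> ~ P b -> ~ P (a * b).
    by move=> Aa Ab na nb /(primeP _ _ Aa Ab) [].
  apply: (localize_descent fv (Dy v fv)).
  - by move=> x Dx; exists 1; rewrite scale1r; split=> //; exact: roi1.
  - move=> x z [a [Aa nPa Da]] [b [Ab nPb Db]]; exists (a * b).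
    split; [exact: roiM | exact: nPM | rewrite scalerDr; apply: DD].
      by rewrite mulrC -scalerA; exact: DZ.
    by rewrite -scalerA; exact: DZ.
  - move=> c x /vP [s [As nPs Asc]] [b [Ab nPb Db]]; exists (s * b).
    split; [exact: roiM | exact: nPM |].
    by rewrite scalerA mulrAC -scalerA; exact: DZ.
by apply: nPa; apply: JP.
Qed.

End LocalGlobal.

(** * Extension of places *)

Section PlaceIdeal.
Variables (R : realType) (F : fieldType).
Hypothesis hF : int_dependent F.
Local Notation A := (@ring_of_integers F).
Variable w : place R F.
Hypothesis fw : finite_place w.
Let aw := pabs_abs w.

Definition place_ideal : set F := [set x | A x /\ w x < 1].

Lemma place_ideal_prime : roi_prime place_ideal.
Proof.
split.
- split; first by move=> x [].
  + by move=> x y [Ax x1] [Ay y1]; split; [exact: roiD | exact: place_ltD].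
  + move=> a x Aa [Ax x1]; split; first exact: roiM.
    rewrite absvM //; apply: le_lt_trans x1; rewrite ler_piMl ?absv_ge0 //.
    exact: place_roi_le1.
- by move=> [_]; rewrite absv1 // ltxx.
- move=> x y Ax Ay [_ xy1].
  have [x1|x1] := ltP (w x) 1; first by left.
  have [y1|y1] := ltP (w y) 1; first by right.
  by move: xy1; rewrite absvM // ltNge mulr_ege1.
Qed.

Lemma place_ideal_nat : exists2 m, (0 < m)%N & place_ideal m%:R.
Proof.
have [x x0 wx] := place_uniformizer fw.
have [d d0 Adx] := roi_denom hF x.
have [m m0 [b Ab e]] := roi_dvd_nat hF Adx (mulf_neq0 (natf_neq0_id hF d0) x0).
exists m => //; split; first exact: roi_nat.
have h : w (d%:R * x) < 1.
  rewrite absvM // wx; apply: (@le_lt_trans _ _ (1 * 2^-1)).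
    by rewrite ler_wpM2r ?invr_ge0 ?ler0n // place_nat_le1.
  by rewrite mul1r invf_lt1 ?ltr1n ?ltr0n.
rewrite -e absvM //; apply: le_lt_trans h.
by rewrite ler_piMr ?absv_ge0 // place_roi_le1.
Qed.

Lemma place_ideal_loc_le1 x : roi_loc place_ideal x -> w x <= 1.
Proof.
move=> [s [As nPs /(place_roi_le1 fw)]].
have ws : w s = 1.
  apply/eqP; rewrite eq_le place_roi_le1 //= leNgt; apply/negP => h.
  by apply: nPs.
by rewrite absvM // ws mul1r.
Qed.

(** A uniformizer of the localization has value [2 ^ k] with [k < 0]; since [w] takes the value
    [2^-1], [k] divides -1. *)
Lemma place_ideal_uniformizer : exists pi, [/\ place_ideal pi, w pi = 2^-1 &
  forall x, x != 0 -> exists (k : int) u,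
    [/\ roi_loc place_ideal u, roi_loc place_ideal u^-1 & x = u * pi ^ k]].
Proof.
have [m m0 Pm] := place_ideal_nat.
have [pi [pi0 Ppi _ piE]] := roi_loc_uniformizer hF place_ideal_prime m0 Pm.
exists pi; split => //.
have unit1 u : roi_loc place_ideal u -> roi_loc place_ideal u^-1 -> u != 0 -> w u = 1.
  move=> /place_ideal_loc_le1 u1 /place_ideal_loc_le1; rewrite absvV // => u2 u0.
  apply/eqP; rewrite eq_le u1 /=; rewrite invf_le1 ?absv_gt0 // in u2.
have [k wk] := place_exp2 fw pi0.
have [x x0 wx] := place_uniformizer fw.
have [l [u [Vu Vu1 xE]]] := piE x x0.
have u0 : u != 0 by apply: contraNneq x0 => u0; rewrite xE u0 mul0r.
have : k * l = -1.
  have : (2 : R) ^ (k * l) = 2 ^ (-1).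
    by rewrite -exprz_exp -wk -absvXz // exprN1 -wx xE absvM // (unit1 u) // mul1r.
  by apply: ieexprIz; rewrite ?ltr0n ?pnatr_eq1.
have k0 : k < 0.
  have [_] := Ppi; rewrite wk -[X in _ < X](expr0z (2 : R)) ltr_eXz2l ?ltr1n //.
move=> kl; have l0 : 0 < l by nia.
have k1 : -1 <= k by nia.
by rewrite wk (_ : k = -1) //; lia.
Qed.

End PlaceIdeal.

Lemma roi_rmorph_inj (F F' : fieldType) (j : {rmorphism F -> F'}) x :
  @ring_of_integers F' (j x) -> @ring_of_integers F x.
Proof.
move=> [p mp /rootP pj]; exists p => //; apply/rootP/eqP.
rewrite -(fmorph_eq0 j) -horner_map -map_poly_comp /=.
rewrite (eq_map_poly (g := intr)) ?pj // => z; exact: rmorph_int.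
Qed.

Lemma roi_rmorph (F F' : fieldType) (j : {rmorphism F -> F'}) x :
  @ring_of_integers F x -> @ring_of_integers F' (j x).
Proof.
move=> [p mp /rootP pj]; exists p => //; apply/rootP.
rewrite (eq_map_poly (g := j \o intr)) => [|z]; last by rewrite /= rmorph_int.
by rewrite map_poly_comp horner_map pj rmorph0.
Qed.

Section Extension.
Variables (R : realType) (F F' : fieldType) (j : {rmorphism F -> F'}).
Hypotheses (hF : int_dependent F) (hF' : int_dependent F').
Local Notation A := (@ring_of_integers F).
Local Notation A' := (@ring_of_integers F').

(* The extended ideal is proper: an equation [1 = \sum_i a_i * j p_i] multiplied
   by [theta], where [theta * P] is integral, makes [theta] integral. *)
Lemma prime_extension (P : set F) m : roi_prime P -> (0 < m)%N -> P m%:R ->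
  exists2 Q, roi_prime Q & forall x, A x -> (Q (j x) <-> P x).
Proof.
move=> prP m0 Pm; have [[PA PD PM] P1 primeP] := prP.
have [theta [nAt tP]] := prime_inverse hF prP m0 Pm.
pose J := [set z | exists2 s : seq (F' * F),
  forall q, q \in s -> A' q.1 /\ P q.2 & z = \sum_(q <- s) q.1 * j q.2].
have JP p : P p -> J (j p).
  move=> Pp; exists [:: (1, p)]; last by rewrite big_seq1 mul1r.
  by move=> q; rewrite inE => /eqP -> /=; split=> //; exact: roi1.
have J1 : ~ J 1.
  move=> [s sP e]; apply: nAt; apply: (roi_rmorph_inj (j := j)).
  rewrite -[j theta]mulr1 e mulr_sumr big_seq_cond; apply: roi_sum => q.
  rewrite andbT => /sP [Aq Pq]; rewrite mulrCA -rmorphM /=.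
  by apply: roiM => //; exact/roi_rmorph/tP.
have idJ : roi_ideal J.
  split.
  - move=> _ [s sP ->]; rewrite big_seq_cond; apply: roi_sum => q.
    by rewrite andbT => /sP [Aq Pq]; apply: roiM => //; exact/roi_rmorph/PA.
  - move=> _ _ [s sP ->] [t tP' ->]; exists (s ++ t); last by rewrite big_cat.
    by move=> q; rewrite mem_cat => /orP [/sP|/tP'].
  - move=> a _ Aa [s sP ->]; exists [seq (a * q.1, q.2) | q <- s].
      by move=> _ /mapP [q /sP [Aq Pq] ->]; split=> //; exact: roiM.
    by rewrite big_map mulr_sumr; apply: eq_bigr => q _; rewrite mulrA.
have Jm : J m%:R by rewrite -(rmorph_nat j); exact: JP.
have [Q prQ JQ] := roi_maximal hF' m0 idJ Jm J1.
exists Q => // x Ax; split=> [Qx|/JP /JQ //].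
have [[QA QD QM] Q1 _] := prQ.
apply: contrapT => nPx.
(* For [x] outside [P], two congruent powers give [x ^+ (l - k) - 1] in [P]; with [j x] in [Q] this
   would put 1 in [Q]. *)
have [k [l [lkl [b Ab e]]]] := roi_pigeonhole hF m0 (fun k => roiX k Ax).
have nPX i : ~ P (x ^+ i).
  elim: i => [|i IH]; first by rewrite expr0.
  by rewrite exprS => /(primeP _ _ Ax (roiX i Ax)) [].
have : P (x ^+ k * (x ^+ (l - k) - 1)).
  by rewrite mulrBr mulr1 -exprD subnKC ?(ltnW lkl) // e mulrC; exact: PM.
case/primeP; [exact: roiX | by apply: roiB; [exact: roiX | exact: roi1] | exact: nPX |].
move=> /JP /JQ; rewrite rmorphB rmorphXn rmorph1 => Q2; apply: Q1.
have -> : 1 = j x ^+ (l - k) + (-1) * (j x ^+ (l - k) - 1) by ring.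
apply: QD; last by apply: QM => //; exact/roiN/roi1.
rewrite -(subnSK lkl) exprSr; apply: QM => //; exact/roiX/QA.
Qed.

(** The new place belongs to a prime above that of [w]. Units of the localization have value 1 at
    both places, so the value at one uniformizer determines [e]. *)
Lemma place_extension (w : place R F) : finite_place w ->
  exists w' : place R F', finite_place w' /\
    exists2 e, (0 < e)%N & forall x, w' (j x) = w x ^+ e.
Proof.
move=> fw; have prP := place_ideal_prime fw.
have [m m0 Pm] := place_ideal_nat hF fw.
have [Q prQ QP] := prime_extension prP m0 Pm.
have Qm : Q m%:R by rewrite -(rmorph_nat j); apply/QP => //; exact: roi_nat.
have [w' [fw' w'Q Q1]] := prime_place R hF' prQ m0 Qm.
have aw := pabs_abs w; have aw' := pabs_abs w'.
have [pi [Ppi wpi piE]] := place_ideal_uniformizer hF fw.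
have loc_j u : roi_loc (place_ideal w) u -> w' (j u) <= 1.
  move=> [s [As nPs Asu]]; apply/w'Q; exists (j s); split.
  - exact: roi_rmorph.
  - by rewrite QP.
  - by rewrite -rmorphM; exact: roi_rmorph.
have unit1 (f : F -> R) u : absolute_value f -> f u <= 1 -> f u^-1 <= 1 -> u != 0 -> f u = 1.
  move=> af u1; rewrite (absvV af) => u2 u0.
  by apply/eqP; rewrite eq_le u1 /= -invf_le1 ?absv_gt0.
have awj : absolute_value (w' \o j).
  split=> [x|x|x y|x y] /=; first exact: absv_ge0.
  - by rewrite absv_eq0 // fmorph_eq0.
  - by rewrite rmorphM absvM.
  - by rewrite rmorphD absvD.
have pi0 : pi != 0 by rewrite -(absv_eq0 aw) wpi invr_eq0 pnatr_eq0.
have [k wk] : exists k : int, w' (j pi) = 2 ^ k.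
  by apply: place_exp2; rewrite ?fmorph_eq0.
have k0 : k < 0.
  have := Q1 _ (proj2 (QP _ (proj1 Ppi)) Ppi).
  by rewrite wk -[X in _ < X](expr0z (2 : R)) ltr_eXz2l ?ltr1n.
exists w'; split=> //; exists `|k|%N; first by rewrite absz_gt0 lt_eqF.
move=> x; have [->|x0] := eqVneq x 0.
  by rewrite rmorph0 !absv0 // expr0n absz_eq0 lt_eqF.
have [l [u [Vu Vu1 xE]]] := piE x x0.
have u0 : u != 0 by apply: contraNneq x0 => u0; rewrite xE u0 mul0r.
have wu : w u = 1 by apply: unit1 => //; exact: place_ideal_loc_le1.
have wju : w' (j u) = 1 by apply: (unit1 (w' \o j)) => //; exact: loc_j.
have -> : w x = w pi ^ l by rewrite xE (absvM aw) (absvXz aw) wu mul1r.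
have -> : w' (j x) = w' (j pi) ^ l.
  by rewrite xE -[LHS]/((w' \o j) _) (absvM awj) (absvXz awj) /= wju mul1r.
rewrite wk wpi -exprN1 exprnP !exprz_exp; congr (_ ^ _).
by rewrite lez0_abs ?ltW //; ring.
Qed.

End Extension.

Lemma int_dependent_rat (V : fieldExtType rat) : int_dependent V.
Proof.
have intA (z : int) : (z%:~R : rat)%:A = z%:~R :> V.
  by rewrite -[LHS]/(in_alg V _) rmorph_int.
split=> [m m0|].
  rewrite -(rmorph_nat (in_alg V)) fmorph_eq0 pnatr_eq0 -lt0n //.
exists (\dim {:V}).+1 => x.
pose X := [tuple x i | i < (\dim {:V}).+1].
have : ~~ free X.
  apply/negP => /eqP fX; have := dimvS (subvf <<X>>%VS).
  by rewrite fX size_tuple ltnn.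
move=> /negP nfree.
have [c [[i ci] e]] : exists c : 'I_(\dim {:V}).+1 -> rat,
    (exists i, c i != 0) /\ \sum_i c i *: X`_i = 0.
  apply: contrapT => nex; apply: nfree; apply/freeP => c e i.
  by apply: contrapT => ci; apply: nex; exists c; split=> //; exists i; apply/eqP.
pose d : int := \prod_j denq (c j).
have d0 : d != 0 by apply/prodf_neq0 => j _; rewrite denq_neq0.
have cE j : (numq (c j) * \prod_(k | k != j) denq (c k))%:~R = d%:~R * c j :> rat.
  rewrite (_ : d = denq (c j) * \prod_(k | k != j) denq (c k)); last by rewrite /d (bigD1 j).
  rewrite !intrM -[X in _ = _ * X](divq_num_den (c j)).
  by rewrite [RHS]mulrC -mulrA mulKf // intr_eq0 denq_neq0.
exists (fun j => numq (c j) * \prod_(k | k != j) denq (c k)); split.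
  by exists i; rewrite -(intr_eq0 rat) cE mulf_neq0 ?intr_eq0.
transitivity (d%:~R *: (\sum_j c j *: X`_j)); last by rewrite e scaler0.
rewrite scaler_sumr; apply: eq_bigr => j _.
by rewrite -intA cE -tnth_nth tnth_mktuple scalerA mulr_algl.
Qed.

Lemma int_dependent_ext (K : fieldExtType rat) (E : fieldExtType K) : int_dependent E.
Proof. exact: (int_dependent_rat (baseFieldType E)). Qed.

(** * Approximation at places of local degree one *)

Section LiesOver.
Variables (R : realType) (K : fieldType) (E : fieldExtType K).
Variables (v : place R K) (w : place R E).
Hypothesis fv : finite_place v.

(** An infinite place has value 2 at 2, while [v 2%:R <= 1]. *)
Lemma lies_over_finite e : lies_over_with v w e -> finite_place w.
Proof.
move=> [_ ew]; case: (pabs_norm w) => // iw.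
have := ew 2%:R; rewrite -[_%:A]/(in_alg E _) rmorph_nat iw => e2.
have : v 2%:R ^+ e <= 1 by rewrite exprn_ile1 ?place_nat_le1 // absv_ge0 //; exact: pabs_abs.
by rewrite -e2 leNgt ltr1n.
Qed.

Lemma inertia_degree_gt0 f : inertia_degree v w f -> (0 < f)%N.
Proof.
move=> [x [_ h _]]; case: f x h => // x h; have aw := pabs_abs w.
have [|c _] := h 1; first by rewrite absv1.
by rewrite big_ord0 subr0 absv1 // ltxx.
Qed.

Hypothesis e1 : lies_over_with v w 1.
Let fw := lies_over_finite e1.
Let av := pabs_abs v.
Let aw := pabs_abs w.
Let wv a : w a%:A = v a. Proof. by case: e1 => _ /(_ a); rewrite expr1. Qed.

Hypothesis f1 : inertia_degree v w 1.

(** The single element [x] of the residue basis need not reduce to 1. If [c * x] approximates 1 and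
    [d * x] approximates [y], then [d / c] approximates [y]. *)
Lemma residue_approx y : w y <= 1 -> exists a, w (y - a%:A) < 1.
Proof.
move=> y1; have [x [x1 h _]] := f1.
have h' z : w z <= 1 -> exists2 c, v c <= 1 & w (z - c%:A * x ord0) < 1.
  move=> /h [c c1]; rewrite big_ord1 => zc.
  by exists (c ord0) => //; rewrite mulr_algl.
have [|c c1 hc] := h' 1; first by rewrite absv1.
have [d d1 hd] := h' y y1.
have cx : w (c%:A * x ord0) = 1.
  apply/eqP; rewrite eq_le; apply/andP; split.
    by rewrite absvM // wv mulr_ile1 ?absv_ge0.
  rewrite leNgt; apply/negP => lt1.
  have : w 1 < 1 by rewrite -(subrK (c%:A * x ord0) 1); apply: place_ltD.
  by rewrite absv1 // ltxx.
have vc : v c = 1.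
  apply/eqP; rewrite eq_le c1 leNgt; apply/negP => lt1.
  have : w (c%:A * x ord0) < 1.
    rewrite absvM // wv; apply: le_lt_trans lt1.
    by rewrite ler_piMr ?absv_ge0.
  by rewrite cx ltxx.
have c0 : c != 0 by rewrite -(absv_eq0 av) vc oner_eq0.
exists (d / c).
have c0A : c%:A != 0 :> E by rewrite -[_%:A]/(in_alg E c) fmorph_eq0.
have -> : (d / c)%:A = d%:A / c%:A :> E by exact: (fmorph_div (in_alg E)).
have -> : y - d%:A / c%:A = (y - d%:A * x ord0) - d%:A / c%:A * (1 - c%:A * x ord0).
  by field.
apply: place_ltD => //; rewrite absvN // absvM //.
apply: le_lt_trans hc; rewrite ler_piMl ?absv_ge0 //.
by rewrite absvM // absvV // !wv vc invr1 mulr1.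
Qed.

(** A uniformizer of [v] is one of [w] too. Scaling the error by its powers and approximating the
    residue gains a factor 2 at each step. *)
Lemma place_approx y e : 0 < e -> exists a, w (y - a%:A) < e.
Proof.
move=> e0; have [pi pi0 vpi] := place_uniformizer fv.
have step (k : int) z : w z <= 2 ^ k -> exists a, w (z - a%:A) <= 2 ^ (k - 1).
  move=> zk; have vpk : v (pi ^ (- k)) = 2 ^ k.
    by rewrite absvXz // vpi -exprN1 exprz_exp; congr (_ ^ _); ring.
  have p0 : pi ^ (- k) != 0 by rewrite expfz_neq0.
  have pA0 : (pi ^ (- k))%:A != 0 :> E by rewrite -[_%:A]/(in_alg E _) fmorph_eq0.
  have [|a ha] := @residue_approx (z / (pi ^ (- k))%:A).
    by rewrite absvM // absvV // wv vpk ler_pdivrMr ?exprz_gt0 // mul1r.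
  exists (a * pi ^ (- k)); apply: place_lt_exp2 => //.
  have -> : z - (a * pi ^ (- k))%:A = (z / (pi ^ (- k))%:A - a%:A) * (pi ^ (- k))%:A.
    by rewrite -[(a * _)%:A]/(in_alg E _) rmorphM /= mulrBl divfK.
  by rewrite absvM // wv vpk -[X in _ < X]mul1r ltr_pM2r ?exprz_gt0.
have iter_step (k : int) z (N : nat) : w z <= 2 ^ k ->
    exists a, w (z - a%:A) <= 2 ^ (k - N%:Z).
  move=> zk; elim: N => [|N [a ha]]; first by exists 0; rewrite scale0r !subr0.
  have [b hb] := step _ _ ha; exists (a + b).
  rewrite scalerDl opprD addrA; apply: le_trans hb _.
  by rewrite (_ : k - N.+1%:Z = k - N%:Z - 1) //; lia.
have [k yk] : exists k : int, w y <= 2 ^ k.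
  have [->|/(place_exp2 fw) [k ->]] := eqVneq y 0; last by exists k.
  by exists 0; rewrite absv0.
have kN N : (2 : R) ^ (k - N%:Z) = 2 ^ k / 2 ^+ N by rewrite expfzDr ?pnatr_eq0 // -invr_expz.
pose N := Num.bound (2 ^ k / e).
have [a ha] := iter_step k y N yk; exists a; apply: le_lt_trans ha _.
rewrite kN ltr_pdivrMr ?exprn_gt0 ?ltr0n // mulrC -ltr_pdivrMr //.
apply: lt_le_trans (archi_boundP _) _; first by rewrite divr_ge0 ?exprz_ge0 ?ler0n // ltW.
by rewrite -natrX ler_nat ltnW // ltn_expl.
Qed.

End LiesOver.

(** * Local degree one *)

Lemma natSinv_lt (R : realType) (e : R) : 0 < e -> exists N : nat, forall k,
  (N <= k)%N -> k.+1%:R^-1 < e.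
Proof.
move=> e0; exists (Num.bound e^-1) => k le_k.
rewrite -[e]invrK ltf_pV2 ?posrE ?invr_gt0 ?ltr0n //.
apply: lt_le_trans (archi_boundP _) _; first by rewrite invr_ge0 ltW.
by rewrite ler_nat ltnW.
Qed.

Section LocalDegree.
Variables (R : realType) (K : fieldType) (B : falgType K) (n : nat).
Variables (M : splittingFieldType K) (L : {subfield M}).
Variables (iota : {lrmorphism subvs_of L -> B}) (O : set B) (v : place R K).
Variables (l : localization B n v) (fr : local_frame iota O l).
Hypothesis fv : finite_place v.
Variable i : 'I_(fr_g fr).
Hypothesis e1 : lies_over_with v (fr_P fr i) 1.
Hypothesis f1 : inertia_degree v (fr_P fr i) 1.

(** By density [y] is a limit of elements of [K]; these form a Cauchy sequence in the completion of
    [K], and its limit there is [c]. *)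
Lemma local_field_scalar (y : fr_LP i) : exists c : locF l, y = c%:A.
Proof.
have [al aloci dense complete] := loc_completion l.
have [aP aPi denseP _] := fr_LP_completion i.
have aw := pabs_abs (fr_P fr i).
have [e eE] := fr_LP_abs i.
have approx k : exists a : K, fr_absLP (y - fr_iLP fr i a%:A) < k.+1%:R^-1.
  have k2 : 0 < (k.+1%:R^-1 : R) / 2 by rewrite divr_gt0 ?invr_gt0 ?ltr0n.
  have [x hx] := denseP y _ k2.
  have [a ha] := place_approx fv e1 f1 x k2; exists a.
  rewrite -[y](subrK (fr_iLP fr i x)) -addrA; apply: le_lt_trans (absvD aP _ _) _.
  by rewrite [X in _ < X]splitr ltrD // -rmorphB aPi.
have /choice [s sP] := approx.
have ssE j k : fr_absLP (fr_iLP fr i (s j)%:A - fr_iLP fr i (s k)%:A) =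
    locabs l (loci l (s j) - loci l (s k)).
  rewrite -!rmorphB aPi aloci -[(s j)%:A]/(in_alg _ _) -[(s k)%:A]/(in_alg _ _).
  by rewrite -rmorphB; have [_ ->] := e1; rewrite expr1.
have [c hc] : exists c : locF l, forall e, 0 < e -> exists N, forall j, (N <= j)%N ->
    locabs l (loci l (s j) - c) < e.
  apply: complete => d d0; have d2 : 0 < d / 2 by rewrite divr_gt0 ?ltr0n.
  have [N hN] := natSinv_lt d2; exists N => j k Nj Nk; rewrite -ssE.
  rewrite -[fr_iLP fr i (s j)%:A](subrK y) -addrA.
  apply: le_lt_trans (absvD aP _ _) _; rewrite [X in _ < X]splitr absvB // ltrD //.
    exact: lt_trans (sP j) (hN j Nj).
  exact: lt_trans (sP k) (hN k Nk).
exists c; apply/eqP; rewrite -subr_eq0 -(absv_eq0 aP) eq_le absv_ge0 // andbT leNgt.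
apply/negP => d0; set d := fr_absLP _ in d0.
have e0 : (0 < e)%N.
  case: (e) eE => // /(_ 0); rewrite expr0 scale0r absv0 // => /eqP.
  by rewrite eq_sym oner_eq0.
have d2 : 0 < d / 2 by rewrite divr_gt0 ?ltr0n.
have [N hN] := natSinv_lt d2.
(* The absolute values are compared through a power [e] known only to be positive; below 1, raising
   to it does not increase. *)
have [|N' hN'] := hc (Num.min 1 (d / 2)); first by rewrite lt_min ltr01.
set k := maxn N N'.
have h1 := lt_trans (sP k) (hN k (leq_maxl _ _)).
have h2 : fr_absLP (fr_iLP fr i (s k)%:A - c%:A) < d / 2.
  rewrite fr_iLP_K -[(loci l _)%:A]/(in_alg _ _) -[c%:A]/(in_alg _ _) -rmorphB /= eE.
  have := hN' k (leq_maxr _ _); rewrite lt_min => /andP [c1 c2].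
  apply: le_lt_trans c2; rewrite -[X in _ <= X]expr1.
  by apply: ler_wiXn2l => //; [exact: absv_ge0 | exact: ltW].
have : d < d.
  rewrite {1}/d -[y](subrK (fr_iLP fr i (s k)%:A)) -addrA.
  by apply: le_lt_trans (absvD aP _ _) _; rewrite [X in _ < X]splitr ltrD.
by rewrite ltxx.
Qed.

Lemma local_degree_one : fr_r fr i = 1%N /\ fr_m fr = 1%N.
Proof.
have /eqP : (fr_r fr i * fr_m fr = 1)%N.
  rewrite fr_rE; apply/eqP; rewrite eqn_leq; apply/andP; split.
    apply: (@leq_trans (\dim (1%VS : {vspace fr_LP i}))); last by rewrite dimv1.
    apply: dimvS; apply/subvP => y _.
    have [c ->] := local_field_scalar y.
    by apply/vlineP; exists c.
  apply: (@leq_trans (\dim (1%VS : {vspace fr_LP i}))); first by rewrite dimv1.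
  by apply: dimvS; exact: subvf.
by rewrite muln_eq1 => /andP [/eqP ? /eqP ?].
Qed.

End LocalDegree.

(* The place above [v] extends further to [N], where the ramification index is
   at least as large. *)
Lemma unramified_sub (R : realType) (K : fieldExtType rat) (M : splittingFieldType K)
    (L N : {subfield M}) (v : place R K) : (L <= N)%VS -> finite_place v ->
  unramified (subvs_of N) v -> unramified (subvs_of L) v.
Proof.
move=> LN fv unN w [e eE]; have fw := lies_over_finite fv eE.
pose f (x : subvs_of L) := vsproj N (vsval x).
have fE x : vsval (f x) = vsval x by apply/vsprojK/(subvP LN)/subvsP.
have f_zmod : zmod_morphism f by move=> x y; rewrite /f !raddfB.
have f_monoid : monoid_morphism f.
  split=> [|x y]; apply: val_inj; first by rewrite [LHS]fE -[RHS]/(vsval 1) !rmorph1.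
  by rewrite [LHS]fE -[RHS]/(vsval (f x * f y)) !rmorphM /= !fE.
pose fz := GRing.isZmodMorphism.Build _ _ f f_zmod.
pose fm := GRing.isMonoidMorphism.Build _ _ f f_monoid.
pose j : {rmorphism subvs_of L -> subvs_of N} := HB.pack f fz fm.
have [w' [fw' [e' e'0 w'E]]] :=
  place_extension j (int_dependent_ext _) (int_dependent_ext _) fw.
have [e0 wE] := eE.
have w'A a : w' a%:A = v a ^+ (e * e').
  rewrite exprM -wE -w'E; congr (w' _); apply: val_inj.
  by rewrite [RHS]fE -[LHS]/(vsval a%:A) !linearZ /= !algid1.
have [_ w'1] : lies_over_with v w' 1.
  by apply: unN; exists (e * e')%N; split; rewrite ?muln_gt0 ?e0.
have [x x0 vx] := place_uniformizer fv.
have : (2^-1 : R) ^+ (e * e') = 2^-1 ^+ 1 by rewrite -vx -w'A -w'1.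
have h1 : 2^-1 != 1 :> R by rewrite invr_eq1 pnatr_eq1.
have h0 : 0 < 2^-1 :> R by rewrite invr_gt0 ltr0n.
move=> /(ieexprIn h0 h1) /eqP; rewrite muln_eq1 => /andP [/eqP e1 _].
by rewrite -e1.
Qed.

(** * Local orders *)

Section LocalOrders.
Variables (R : realType) (K : fieldType) (B : falgType K) (n : nat).
Variables (M : splittingFieldType K) (L : {subfield M}).
Variables (iota : {lrmorphism subvs_of L -> B}) (O : set B) (v : place R K).
Variables (l : localization B n v) (fr : local_frame iota O l).
Local Notation Delta := (@fr_Delta _ _ _ _ _ _ _ _ _ _ fr).
Local Notation pi := (fr_pi fr).
Local Notation s := (fr_size fr).

Lemma loc_integers0 : loc_integers l 0.
Proof. by have [al _ _ _] := loc_completion l; rewrite /loc_integers /= (absv0 al). Qed.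

Lemma Delta1 : Delta 1. Proof. by case: (fr_Delta_max fr) => [[]]. Qed.

Lemma DeltaM x y : Delta x -> Delta y -> Delta (x * y).
Proof. by case: (fr_Delta_max fr) => [[_ + _] _]; exact. Qed.

Lemma Delta0 : Delta 0.
Proof.
case: (fr_Delta_max fr) => [[_ _ [t _ ->]] _]; exists (fun=> 0).
  by move=> _; exact: loc_integers0.
by rewrite big1 // => i _; rewrite scale0r.
Qed.

Lemma frD_unit (x : fr_D fr) : x != 0 -> x \is a GRing.unit.
Proof. by case: (fr_D_division fr) => _ + _; exact. Qed.

Lemma pi_unit : pi \is a GRing.unit.
Proof. by apply: frD_unit; case: (fr_pi_unif fr). Qed.

Lemma Delta_pi : Delta pi.
Proof.
have [_ /seteqP [_ h]] := fr_pi_unif fr.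
have [|//] := h pi; exists 1; [exact: Delta1 | exact: mulr1].
Qed.

Lemma Delta_piX k : Delta (pi ^+ k).
Proof.
by elim: k => [|k IH]; [exact: Delta1 | rewrite exprS; exact: DeltaM Delta_pi IH].
Qed.

Lemma Delta_piV : ~ Delta pi^-1.
Proof.
have [_ /seteqP [_ h]] := fr_pi_unif fr => D.
have [|_] := h pi; first by exists 1; [exact: Delta1 | exact: mulr1].
by apply; split=> //; exact: pi_unit.
Qed.

Lemma Delta_piz (k : int) : Delta (pi ^ k) -> 0 <= k.
Proof.
case: k => // k; rewrite NegzE -exprnN => D; case: Delta_piV.
suff -> : pi^-1 = pi ^- k.+1 * pi ^+ k by apply: DeltaM => //; exact: Delta_piX.
by rewrite exprSr invrM ?unitrX ?pi_unit // -mulrA mulVr ?mulr1 // unitrX ?pi_unit.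
Qed.

(* [y * pi] is again a nonunit of [Delta], hence lies in [pi * Delta]. *)
Lemma Delta_conj1 y : Delta y -> Delta (pi^-1 * y * pi).
Proof.
move=> Dy; have [_ /seteqP [h _]] := fr_pi_unif fr.
have [|z Dz e] := h (y * pi); last by rewrite -mulrA -e mulKr ?pi_unit.
split; first exact: DeltaM Dy Delta_pi.
move=> [U D]; apply: Delta_piV.
suff -> : pi^-1 = (y * pi)^-1 * y by exact: DeltaM.
have Uy : y \is a GRing.unit.
  by apply: frD_unit; apply: contraTneq U => ->; rewrite mul0r unitr0.
by rewrite invrM ?pi_unit // mulrVK.
Qed.

Lemma Delta_conj (k : int) y : 0 <= k -> Delta y -> Delta (pi ^ (- k) * y * pi ^ k).
Proof.
case: k => // k _ Dy; rewrite -exprnN -exprnP.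
elim: k => [|k IH]; first by rewrite expr0 invr1 mul1r mulr1.
suff -> : pi ^- k.+1 * y * pi ^+ k.+1 = pi^-1 * (pi ^- k * y * pi ^+ k) * pi.
  exact: Delta_conj1.
by rewrite {1}exprSr exprSr invrM ?unitrX ?pi_unit // !mulrA.
Qed.

Lemma class_orderP (a : 'I_s -> int) y : class_order a y <->
  forall i j, Delta (pi ^ (- a i) * fr_phi fr y i j * pi ^ a j).
Proof.
have piK k : pi ^ (- k) * pi ^ k = 1.
  by rewrite -exprzDr ?pi_unit // addNr expr0z.
have piVK k : pi ^ k * pi ^ (- k) = 1.
  by rewrite -exprzDr ?pi_unit // addrN expr0z.
have entry (A : 'M[fr_D fr]_s) i j :
    (pi_diag a *m A *m pi_diag (fun i => - a i)) i j = pi ^ a i * A i j * pi ^ (- a j).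
  by rewrite mul_mx_diag mul_diag_mx !mxE.
split=> [[A DA yE] i j | h].
  rewrite yE entry !mulrA piK mul1r -mulrA piK mulr1; exact: DA.
exists (\matrix_(i, j) (pi ^ (- a i) * fr_phi fr y i j * pi ^ a j)).
  by move=> i j; rewrite mxE; exact: h.
by apply/matrixP => i j; rewrite entry mxE !mulrA piVK mul1r -mulrA piVK mulr1.
Qed.

(** Where the matrix is nonzero the two exponents agree, and conjugation by a power of [pi]
    preserves [Delta]. *)
Lemma class_order_of_blocks (a : 'I_s -> int) y : (forall i, 0 <= a i) ->
  (forall i j, Delta (fr_phi fr y i j)) ->
  (forall i j, a i <> a j -> fr_phi fr y i j = 0) -> class_order a y.
Proof.
move=> a0 Dy off; apply/class_orderP => i j.
have [e|/eqP /off ->] := eqVneq (a i) (a j).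
  by rewrite e; exact: Delta_conj.
by rewrite mulr0 mul0r; exact: Delta0.
Qed.

(** The inclusion is tested on the matrix with the single entry [pi ^ (a i - a j)] at [(i, j)]. *)
Lemma class_order_subset (a b : 'I_s -> int) : class_order a `<=` class_order b ->
  forall i j, b i - b j <= a i - a j.
Proof.
move=> sub i j; have [g _ gK] := fr_phi_bij fr.
pose X : 'M[fr_D fr]_s := \matrix_(i', j')
  if (i' == i) && (j' == j) then pi ^ a i * pi ^ (- a j) else 0.
have phiX : fr_phi fr (g X) = X by exact: gK.
have : class_order a (g X).
  apply/class_orderP => i' j'; rewrite phiX mxE; case: ifP => [/andP [/eqP -> /eqP ->]|_].
    rewrite -!exprzDr ?pi_unit // addrA addNr add0r addNr expr0z; exact: Delta1.
  by rewrite mulr0 mul0r; exact: Delta0.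
move=> /sub /class_orderP /(_ i j); rewrite phiX mxE !eqxx /=.
rewrite -!exprzDr ?pi_unit // => /Delta_piz; lia.
Qed.

Lemma fr_phi_offdiag x i j : tagnat.sig1 i != tagnat.sig1 j ->
  fr_phi fr (locB l (iota x)) i j = 0.
Proof. by move=> ne; rewrite fr_psi_diag /mxdiag !mxE (negPf ne) mxE. Qed.

Lemma sig1_inj_size1 (i j : 'I_s) : fr_r fr (tagnat.sig1 i) = 1%N ->
  tagnat.sig1 i = tagnat.sig1 j -> i = j.
Proof.
move=> r1 e; have r1' : fr_r fr (tagnat.sig1 j) = 1%N by rewrite -e.
have le1 (k : 'I_s) : fr_r fr (tagnat.sig1 k) = 1%N -> tagnat.sig2 k = 0%N :> nat.
  by move=> r; case: (tagnat.sig2 k) => m /=; rewrite r; case: m.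
by apply: val_inj; rewrite /= (tagnat.rect i) (tagnat.rect j) !le1 // e.
Qed.

Lemma sig1_first (i : 'I_s) (i0 : 'I_(fr_g fr)) : i0 = 0%N :> nat ->
  (0 < fr_r fr i0)%N -> i = 0%N :> nat -> tagnat.sig1 i = i0.
Proof.
move=> i00 r0 i0'; have := tagnat.RankEsum (Ordinal r0).
rewrite [X in (X + _)%N]big_pred0 => [e|k]; last by rewrite i00.
have -> : i = tagnat.Rank i0 (Ordinal r0) by apply: ord_inj; rewrite i0' e.
exact: tagnat.Rank1K.
Qed.

Lemma fr_phi_entries x : localize l O x -> forall i j, Delta (fr_phi fr x i j).
Proof. by move=> /fr_phi_order. Qed.

Lemma step_order_first k x : (exists2 i0 : 'I_(fr_g fr), i0 = 0%N :> nat & fr_r fr i0 = 1%N) ->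
  localize l O (locB l (iota x)) -> step_order fr 1 k%:Z (locB l (iota x)).
Proof.
move=> [i0 i00 r1] Ox; apply: class_order_of_blocks => [i||i j].
- by case: ifP.
- exact: fr_phi_entries.
have first (i' : 'I_s) : (i' < 1)%N -> tagnat.sig1 i' = i0.
  by rewrite ltnS leqn0 => /eqP i'0; apply: sig1_first; rewrite ?r1.
have other (i' j' : 'I_s) : (i' < 1)%N -> ~~ (j' < 1)%N -> tagnat.sig1 i' != tagnat.sig1 j'.
  move=> i1 j1; apply/eqP => e; move: (j1); rewrite -(@sig1_inj_size1 i' j') ?i1 //.
  by rewrite first.
case: ifP => i1; case: ifP => j1 // _; apply: fr_phi_offdiag.
  by apply: other; rewrite ?j1.
by rewrite eq_sym; apply: other; rewrite ?i1.
Qed.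

Lemma step_order_split k x : (forall i, fr_r fr i = 1%N) ->
  localize l O (locB l (iota x)) -> step_order fr k 1 (locB l (iota x)).
Proof.
move=> r1 Ox; apply: class_order_of_blocks => [i||i j].
- by case: ifP.
- exact: fr_phi_entries.
move=> ne; apply: fr_phi_offdiag; apply: contra_notN ne => /eqP e.
by rewrite (@sig1_inj_size1 i j).
Qed.

(** The residue 0 is [d * 0], and [a = 0] is admissible because [f] is positive. Its exponent vector
    is zero, so the order is the matrix ring over [Delta]. *)
Lemma lambda_orders_0 f ell X x : (0 < f)%N ->
  @lambda_orders _ _ _ _ _ _ _ _ _ _ fr f ell X ->
  localize l O (locB l (iota x)) -> X 0%N (locB l (iota x)).
Proof.
move=> f0 [_ /(_ 0%N f0) [h _]] Ox; rewrite (h 0%N) ?muln0 //.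
  apply/class_orderP => i j; rewrite !mul0r oppr0 !expr0z mul1r mulr1.
  exact: fr_phi_entries.
by rewrite divn_gt0 ?gcdn_gt0 ?f0 ?orbT // dvdn_leq // dvdn_gcdr.
Qed.

Hypothesis m1 : fr_m fr = 1%N.

Lemma frD_scalar : exists c : fr_D fr -> locF l, forall d, d = (c d)%:A.
Proof.
have [_ _ dimD] := fr_D_division fr; rewrite m1 exp1n in dimD.
have full : (1%VS : {vspace fr_D fr}) = fullv.
  by apply/eqP; rewrite eqEdim subvf dimD dimv1.
suff h (d : fr_D fr) : exists c : locF l, d = c%:A.
  by have [c] := choice h; exists c.
have : d \in (1%VS : {vspace fr_D fr}) by rewrite full memvf.
by move=> /vlineP [c ->]; exists c.
Qed.

Lemma fr_phiZ a y : fr_phi fr (a *: y) = \matrix_(i, j) (a *: fr_phi fr y i j).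
Proof.
rewrite -mulr_algl rmorphM fr_phi_scalar; apply/matrixP => i j.
by rewrite -[LHS]/((_ *m _) i j) mul_scalar_mx !mxE mulr_algl.
Qed.

(** As [fr_D] consists of scalars, a basis of [B] maps to independent matrices of size [s] over the
    completion, whence [n ^ 2 <= s ^ 2]. *)
Lemma fr_size_ge : \dim {:B} = (n ^ 2)%N -> (n <= s)%N.
Proof.
move=> dimB; have [c cE] := frD_scalar.
have c_inj d : c d = 0 -> d = 0 by move=> e; rewrite [d]cE e scale0r.
pose e := vbasis {:B}.
pose X := map_tuple (locB l) e.
have fX : free X by exact: basis_free (locB_basis l).
pose A : 'M[locF l]_(\dim {:B}, s * s) :=
  \matrix_(k, p) mxvec (map_mx c (fr_phi fr X`_k)) 0 p.
have fA : row_free A.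
  apply: inj_row_free => r rA; apply/rowP => k; rewrite [RHS]mxE.
  move/freeP: fX => /(_ (fun k => r 0 k)); apply.
  have [g gK _] := fr_phi_bij fr; apply: (can_inj gK); rewrite rmorph0.
  apply/matrixP => i j; rewrite rmorph_sum summxE [RHS]mxE.
  transitivity ((\sum_k r 0 k * c (fr_phi fr X`_k i j))%:A : fr_D fr).
    rewrite scaler_suml; apply: eq_bigr => k' _.
    by rewrite fr_phiZ mxE [in LHS](cE (fr_phi fr X`_k' i j)) scalerA.
  suff -> : \sum_k r 0 k * c (fr_phi fr X`_k i j) = 0 by rewrite scale0r.
  transitivity ((r *m A) 0 (mxvec_index i j)); last by rewrite rA mxE.
  by rewrite mxE; apply: eq_bigr => k' _; rewrite [A _ _]mxE mxvecE [in RHS]mxE.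
have : (\dim {:B} <= s * s)%N by rewrite -(eqP fA) rank_leq_col.
by rewrite dimB -mulnn leq_sqr.
Qed.

End LocalOrders.

(** * Distinctness of the step orders *)

Section FrameOfScalars.
Variables (R : realType) (K : fieldType) (B : falgType K) (n : nat).
Variables (M : splittingFieldType K) (L : {subfield M}).
Variables (iota : {lrmorphism subvs_of L -> B}) (O : set B) (v : place R K).
Variables (l : localization B n v) (fr : local_frame iota O l).

(** With no place above [v] the local algebra would be a ring of empty matrices, in which 1 is 0. *)
Lemma fr_g_gt0 : (0 < fr_g fr)%N.
Proof.
rewrite lt0n; apply/eqP => g0; have [g gK _] := fr_phi_bij fr.
suff : 1 = 0 :> locA l by move/eqP; rewrite oner_eq0.
apply: (can_inj gK); apply/matrixP => i.
by have := ltn_ord (tagnat.sig1 i); rewrite [X in (_ < X)%N]g0.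
Qed.

Lemma step_order_first_inj (k k' : nat) : (1 < fr_size fr)%N ->
  step_order fr 1 k%:Z = step_order fr 1 k'%:Z -> k = k'.
Proof.
move=> s1 e; have s0 := ltnW s1.
have sub1 : step_order fr 1 k%:Z `<=` step_order fr 1 k'%:Z by rewrite e.
have sub2 : step_order fr 1 k'%:Z `<=` step_order fr 1 k%:Z by rewrite e.
have := class_order_subset sub1 (Ordinal s0) (Ordinal s1).
have := class_order_subset sub2 (Ordinal s0) (Ordinal s1).
by rewrite /= !subr0 !lez_nat => h1 h2; apply/eqP; rewrite eqn_leq h1.
Qed.

Lemma step_order_split_inj (k k' : nat) : (k < fr_size fr)%N -> (k' < fr_size fr)%N ->
  step_order fr k 1 = step_order fr k' 1 -> k = k'.
Proof.
wlog kk' : k k' / (k <= k')%N => [H ks k's e|ks k's e].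
  by have [h|/ltnW h] := leqP k k'; [|apply/esym]; apply: H.
apply/eqP; rewrite eqn_leq kk' /= leqNgt; apply/negP => lt.
have sub : step_order fr k 1 `<=` step_order fr k' 1 by rewrite e.
(* The last index carries exponent 0 on both sides since [k] and [k'] are below the size; index [k]
   carries 0 on the left and 1 on the right. *)
have l1 : ((fr_size fr).-1 < fr_size fr)%N by rewrite prednK // (leq_ltn_trans _ ks).
have := class_order_subset sub (Ordinal ks) (Ordinal l1).
by rewrite /= ltnn lt !ifF ?subr0 //; apply/negbTE; rewrite -leqNgt -ltnS prednK //
  (leq_ltn_trans _ ks).
Qed.

End FrameOfScalars.

(* The reduced norm of a scalar [c] is [c ^+ n]. *)
Lemma class_field_exponent (R : realType) (K : fieldType) (B : falgType K) (n : nat)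
    (loc : forall v : place R K, localization B n v) (O : set B)
    (M : splittingFieldType K) (E : {subfield M}) (g : gal_of E) :
  O 1 -> class_field loc O E -> g \in 'Gal(E / 1)%g -> (g ^+ n = 1)%g.
Proof.
move=> O1 [_ _ _ [art [artM artG surj artH _]]] /surj [x Ix <-].
have [x0 finx] := Ix.
have al v : absolute_value (locabs (loc v)) by case: (loc_completion (loc v)).
have IX k : idele_K (fun v => x v ^+ k).
  split; first by move=> v; apply: expf_neq0; exact: x0.
  apply: sub_finite_set finx => v [fv xk]; split=> //; apply: contra_neq xk => x1.
  by rewrite absvX // x1 expr1n.
have artX k : art (fun v => x v ^+ k) = (art x ^+ k)%g.
  elim: k => [|k IH].
    (* The trivial idele is its own square, so its image is the identity. *)
    have := artM _ _ (IX 0%N) (IX 0%N).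
    have -> : (fun v => x v ^+ 0 * x v ^+ 0) = (fun v => x v ^+ 0).
      by apply: functional_extensionality_dep => v; rewrite mulr1.
    set y := art _ => /(congr1 (fun h => y^-1 * h)%g).
    by rewrite mulVg mulKg expg0.
  rewrite expgS -IH -artM //; congr art.
  by apply: functional_extensionality_dep => v; rewrite exprS.
rewrite -artX; apply/artH => //.
have xu v : (x v)%:A \is a @GRing.unit (locA (loc v)).
  by rewrite -[_%:A]/(in_alg _ _) rmorph_unit // unitfE.
exists 1; first exact: oner_neq0.
(* The scalar idele is central, so it normalizes every localization of [O]. *)
exists (fun v => (x v)%:A).
  split; first split=> //.
    apply: sub_finite_set finx => v [fv nO]; split=> //; apply/eqP => x1; apply: nO.
    have inO c : locabs (loc v) c = 1 -> localize (loc v) O c%:A.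
      move=> c1 _; exists [:: 1]; split; first by move=> y /=; rewrite inE => /eqP ->.
      exists (fun=> c); first by move=> _; rewrite /loc_integers /= c1.
      by rewrite big_ord1 /= rmorph1.
    split; first exact: inO.
    have -> : ((x v)%:A)^-1 = (x v)^-1%:A :> locA (loc v).
      by rewrite -[RHS]/(in_alg _ _) rmorphV ?unitfE.
    by apply: inO; rewrite absvV // x1 invr1.
  move=> v z; suff -> : (x v)%:A * z * ((x v)%:A)^-1 = z by [].
  have -> : (x v)%:A * z = z * (x v)%:A by rewrite mulr_algl mulr_algr.
  exact: (mulrK (xu v)).
move=> v; rewrite rmorph1 mul1r.
have [F [h [hA hdet]]] := locnr_reduced_norm (loc v).
have := hdet (x v)%:A; rewrite hA det_scalar => e.
by apply: (fmorph_inj (in_alg F)); rewrite /= -e -[LHS]/(in_alg F _) rmorphXn.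
Qed.

(** * The global family *)

Section Family.
Variables (R : realType) (K : fieldExtType rat) (B : falgType K) (n : nat).
Variables (M : splittingFieldType K) (L N E : {subfield M}).
Variables (iota : {lrmorphism subvs_of L -> B}) (O : set B).
Variable loc : forall v : place R K, localization B n v.
Hypothesis LN : (L <= N)%VS.
Hypothesis oO : is_order (@ring_of_integers K) O.
Variable C : place_choice N E iota O loc.

Lemma mu_first_size1 j : exists2 i0 : 'I_(fr_g (mu_frame C j)), i0 = 0%N :> nat &
  fr_r (mu_frame C j) i0 = 1%N /\ fr_m (mu_frame C j) = 1%N.
Proof.
have [i0 i00 f1] := mu_first j; exists i0 => //.
have ov : lies_over (mu C j) (fr_P (mu_frame C j) i0).
  by apply/(fr_P_over (mu_frame C j)); exists i0.
have unj : unramified (subvs_of N) (mu C j) by move=> w; exact: mu_unramified.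
have e1 := unramified_sub LN (mu_finite j) unj ov.
exact: (local_degree_one (mu_finite j) e1 f1).
Qed.

Lemma nu_size1 k i : fr_r (nu_frame C k) i = 1%N /\ fr_m (nu_frame C k) = 1%N.
Proof.
have ov : lies_over (nu C k) (fr_P (nu_frame C k) i).
  by apply/(fr_P_over (nu_frame C k)); exists i.
have [e1 f1] := nu_splits ov.
exact: (local_degree_one (nu_finite k) e1 f1).
Qed.

Lemma ring_of_integers_sub (a : index_a C) b c X : is_global_order a b c X ->
  iota @` @ring_of_integers (subvs_of L) `<=` O -> (forall i, a i = 0%N :> nat) ->
  iota @` @ring_of_integers (subvs_of L) `<=` X.
Proof.
move=> [[oX _] [Xgen Xlam Xmu Xnu]] LO a0 _ [x Ax <-].
have Ox : O (iota x) by apply: LO; exists x.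
have Olx (v : place R K) (l : localization B n v) : localize l O (locB l (iota x)).
  exact: order_sub_localize.
apply: (order_local_global (int_dependent_rat K) oX (loc := loc)) => v fv.
have [[i ->]|nlam] := pselect (exists i, v = lam C i).
  rewrite Xlam a0; apply: (lambda_orders_0 _ (lam_orderP i)) => //.
  by have [w _ /inertia_degree_gt0] := lam_fP i.
have [[j ->]|nmu] := pselect (exists j, v = mu C j).
  rewrite Xmu; apply: step_order_first => //.
  by have [i0 i00 [r1 _]] := mu_first_size1 j; exists i0.
have [[k ->]|nnu] := pselect (exists k, v = nu C k).
  by rewrite Xnu; apply: step_order_split => // i; case: (nu_size1 i).
rewrite Xgen // => [i e|j e|k e].
- by apply: nlam; exists i.
- by apply: nmu; exists j.
- by apply: nnu; exists k.
Qed.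

Lemma global_order_inj (a a' : index_a C) b b' c c' X : (1 < n)%N ->
  \dim {:B} = (n ^ 2)%N -> class_field loc O E ->
  is_global_order a b c X -> is_global_order a' b' c' X -> b = b' /\ c = c'.
Proof.
move=> n1 dimB cf [_ [_ _ Xmu Xnu]] [_ [_ _ Xmu' Xnu']].
split; apply/ffunP => j; apply: ord_inj.
  have [i0 _ [_ m1]] := mu_first_size1 j.
  have ns := fr_size_ge m1 dimB.
  apply: (@step_order_first_inj _ _ _ _ _ _ _ _ _ _ (mu_frame C j)).
    exact: leq_trans ns.
  by rewrite -Xmu -Xmu'.
have [_ m1] := nu_size1 (Ordinal (fr_g_gt0 (nu_frame C j))).
have ns := fr_size_ge m1 dimB.
(* The number of ones determines the order only while it is below the matrix size; here it is below
   the order of [tau j], which divides [n]. *)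
have tau_le : (#[tau j]%g <= n)%N.
  apply: dvdn_leq; first exact: ltnW.
  have [tG _] := nu_artin j; rewrite order_dvdn.
  by apply/eqP; apply: class_field_exponent cf tG; case: oO.
have lt_s (k : 'I_(#[tau j]%g)) : (k < fr_size (nu_frame C j))%N.
  by apply: leq_trans ns; apply: leq_trans tau_le.
by apply: (@step_order_split_inj _ _ _ _ _ _ _ _ _ _ (nu_frame C j));
  rewrite ?lt_s // -Xnu -Xnu'.
Qed.

(** * Cardinality of the index sets *)

Lemma card_dffun_ord (m : nat) (d : 'I_m -> nat) :
  #|{dffun forall i : 'I_m, 'I_(d i)}| = (\prod_i d i)%N.
Proof.
rewrite card_dep_ffun /image_mem foldrE big_map big_enum.
by apply: eq_bigr => i _; rewrite card_ord.
Qed.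

Hypotheses (galE : galois 1 E) (abE : abelian 'Gal(E / 1)%g).

Let gal_inter_sub (F F' : {subfield M}) : (F <= F')%VS ->
  gal_inter E F' \subset gal_inter E F.
Proof. by move=> FF'; apply: galS; rewrite capvS. Qed.

Let gal_inter_sub1 (F : {subfield M}) : gal_inter E F \subset 'Gal(E / 1)%g.
Proof. by apply: galS; exact: sub1v. Qed.

Let card_quo (G H : {group gal_of E}) : H \subset G -> G \subset 'Gal(E / 1)%g ->
  (#|(G / H)%g| * #|H|)%N = #|G|.
Proof.
move=> HG Gab; have nHG : G \subset 'N(H)%g.
  exact: (sub_abelian_norm (abelianS Gab abE) HG).
by rewrite (card_quotient nHG) mulnC (Lagrange HG).
Qed.

(** The orders of the cyclic factors of [H / H^] and of [H^] multiply to the order of [H], the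
    Galois group of [E] over [L :&: E]. *)
Lemma card_index_bc : #|{: index_b C * index_c C}| = \dim_(L :&: E)%VS E.
Proof.
rewrite card_prod !card_dffun_ord.
rewrite (bigdprod_card (G := (gal_inter E L / gal_inter E N)%G) (sigma_dprod C)).
rewrite (bigdprod_card (tau_dprod C)) card_quo ?gal_inter_sub ?gal_inter_sub1 //.
rewrite -galois_dim //; apply: galoisS galE; rewrite sub1v /=; exact: capvSr.
Qed.

Lemma card_index_abc : #|{: index_a C * index_b C * index_c C}| = \dim E.
Proof.
have := card_index_bc; rewrite !card_prod -mulnA => ->.
rewrite !card_dffun_ord.
rewrite (bigdprod_card (G := ('Gal(E / 1) / gal_inter E L)%G) (rho_dprod C)).
rewrite (galois_dim (K := (L :&: E)%AS)); last first.
  by apply: galoisS galE; rewrite sub1v /=; exact: capvSr.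
by rewrite card_quo ?gal_inter_sub1 // -galois_dim // dimv1 divn1.
Qed.

End Family.

Theorem theorem3p9 (R : realType) (K : fieldExtType rat) (B : falgType K)
    (n : nat) (hn : (3 <= n)%N) (hB : central_simple B n)
    (M : splittingFieldType K) (L : {subfield M}) (hL : \dim L = n)
    (iota : {lrmorphism subvs_of L -> B})
    (O : set B) (hO : maximal_order (@ring_of_integers K) O)
    (hLO : iota @` @ring_of_integers (subvs_of L) `<=` O)
    (loc : forall v : place R K, localization B n v)
    (KO : {subfield M}) (hKO : class_field loc O KO)
    (Lhat : {subfield M}) (hLhat : is_galois_closure L Lhat)
    (C : place_choice Lhat KO iota O loc)
    (D : index_a C -> index_b C -> index_c C -> set B)
    (hD : forall a b c, is_global_order a b c (D a b c)) :
  [/\ #|{: index_a C * index_b C * index_c C}| = \dim KO,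
      `I_(\dim_(L :&: KO)%VS KO) #<=
        [set X : set B | (exists a b c, X = D a b c) /\
           iota @` @ring_of_integers (subvs_of L) `<=` X]
    & forall (a : index_a C) b c, (forall i, a i = 0%N :> nat) ->
        iota @` @ring_of_integers (subvs_of L) `<=` D a b c].
Proof.
have [LN _ _] := hLhat.
have [oO _] := hO.
have [galE abE _ _] := hKO.
have [_ _ dimB] := hB.
have sub (a : index_a C) b c : (forall i, a i = 0%N :> nat) ->
    iota @` @ring_of_integers (subvs_of L) `<=` D a b c.
  exact: (ring_of_integers_sub LN (hD a b c) hLO).
split; [exact: card_index_abc | | exact: sub].
rewrite -(card_index_bc LN C galE abE).
pose a0 : index_a C := [ffun i => Ordinal (order_gt0 (coset (gal_inter KO L) (rho i)))].
pose T := (index_b C * index_c C)%type.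
pose f (i : 'I_#|{: T}|) := D a0 (enum_val i).1 (enum_val i).2.
(* The claim counts distinct subsets of [B], so different pairs of labels must give different
   orders. *)
have f_inj : {in [set: 'I_#|{: T}|] &, injective f}.
  move=> i j _ _ fij; apply: enum_val_inj.
  have hj := hD a0 (enum_val j).1 (enum_val j).2.
  have hi := hD a0 (enum_val i).1 (enum_val i).2.
  rewrite -/(f i) fij in hi.
  have [e1 e2] := global_order_inj LN oO (ltnW hn) dimB hKO hi hj.
  by case: (enum_val i) (enum_val j) e1 e2 => [b c] [b' c'] /= -> ->.
apply: (@card_le_trans _ _ _ [set: 'I_#|{: T}|]).
  by rewrite (card_le_eql card_II).
rewrite -(card_le_eql (inj_card_eq f_inj)); apply: subset_card_le.
move=> _ [i _ <-]; split; first by exists a0, (enum_val i).1, (enum_val i).2.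
by apply: sub => j; rewrite ffunE.
Qed.
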